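(* Let $\{(N_k,B_k)\}_{k=1}^\infty$ be a sequence of admissible pairs with $B_k\subseteq\{0,1,2,\dots\}$ for all $k\ge1$. Suppose that the infinite convolution $\mu(\boldsymbol{\omega})$ exists for every $\boldsymbol{\omega}\in\Omega$ and that $\Phi=\{\mu(\boldsymbol{\omega}):\boldsymbol{\omega}\in\Omega\}$ is tight. Then for every unbounded sequence $\mathbf{n}=\{n_k\}_{k=1}^\infty$ of positive integers, the mapping $\mu^{\mathbf{n}}:\Omega\times\mathcal{B}(\mathbb{R})\to[0,+\infty]$, $(\boldsymbol{\omega},B)\mapsto\mu^{\mathbf{n}}(\boldsymbol{\omega})(B)$, is a spectral random measure.
   Context: $\Omega=\mathbb{N}^{\mathbb{N}}$ with index set $\mathbb{N}=\{1,2,3,\dots\}$ is the set of infinite sequences $\boldsymbol{\omega}=\omega_1\omega_2\cdots$ of positive integers, with the metric $d(\boldsymbol{\alpha},\boldsymbol{\beta})=2^{-|\boldsymbol{\alpha}\wedge\boldsymbol{\beta}|}$, where $|\boldsymbol{\alpha}\wedge\boldsymbol{\beta}|$ is the length of the maximal common initial segment ($d=0$ if the sequences are equal). $\mathcal{F}$ is the Borel $\sigma$-algebra of $\Omega$; $\mathcal{B}(\mathbb{R})$ is the Borel $\sigma$-algebra of $\mathbb{R}$. Admissible pair: for an integer $N\ge2$ and a finite $B\subset\mathbb{Z}$ with $\#B\ge2$, $(N,B)$ is an admissible pair if there is $L\subset\mathbb{Z}$ such that the matrix $\left[\frac{1}{\sqrt{\#B}}e^{-2\pi i\,bl/N}\right]_{b\in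 B,\,l\in L}$ is unitary (in particular $\#L=\#B$). For a finite nonempty $A\subset\mathbb{R}$, $\delta_A=\frac{1}{\#A}\sum_{a\in A}\delta_a$ with $\delta_a$ the Dirac measure at $a$; $cA=\{ca:a\in A\}$; $*$ is convolution. For a sequence $\mathbf{n}=\{n_k\}$ of positive integers and $\boldsymbol{\omega}\in\Omega$, put $$\mu^{\mathbf{n}}_{k}(\boldsymbol{\omega}) =\delta_{N_{\omega_{1}}^{-n_{1}}B_{\omega_{1}}} * \delta_{N_{\omega_{1}}^{-n_{1}}N_{\omega_{2}}^{-n_{2}}B_{\omega_{2}}} * \cdots * \delta_{N_{\omega_{1}}^{-n_{1}}\cdots N_{\omega_{k}}^{-n_{k}}B_{\omega_{k}}}.$$ The infinite convolution $\mu^{\mathbf{n}}(\boldsymbol{\omega})$ is said to exist if $\mu^{\mathbf{n}}_k(\boldsymbol{\omega})$ converges weakly, as $k\to\infty$, to a Borel probability measure on $\mathbb{R}$, and $\mu^{\mathbf{n}}(\boldsymbol{\omega})$ denotes this limit. When $n_k=1$ for all $k$, write $\mu(\boldsymbol{\omega})=\mu^{\mathbf{n}}(\boldsymbol{\omega})$. If $\mu(\boldsymbol{\omega})$ exists then $\mu^{\mathbf{n}}(\boldsymbol{\omega})$ exists for every $\mathbf{n}$, so under the hypotheses the mapping $\mu^{\mathbf{n}}$ is well defined. A set $\Psi$ of Borel probability measures on $\mathbb{R}$ is tight if for each $\epsilon>0$ there is a compact $K\subseteq\mathbb{R}$ with $\inf_{\nu\in\Psi}\nu(K)>1-\epsilon$.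 A mapping $M:\Omega\times\mathcal{B}(\mathbb{R})\to[0,+\infty]$ is a random measure if $\boldsymbol{\omega}\mapsto M(\boldsymbol{\omega},A)$ is $\mathcal{F}$-measurable for every $A\in\mathcal{B}(\mathbb{R})$ and $M(\boldsymbol{\omega})=M(\boldsymbol{\omega},\cdot)$ is a measure for every $\boldsymbol{\omega}\in\Omega$. A Borel probability measure $\nu$ on $\mathbb{R}$ is a spectral measure if there is $\Lambda\subset\mathbb{R}$ such that $\{e^{2\pi i\lambda x}:\lambda\in\Lambda\}$ is an orthonormal basis of $L^2(\nu)$. A random measure $M$ is a spectral random measure if $M(\boldsymbol{\omega})$ is a spectral measure for all $\boldsymbol{\omega}\in\Omega$. *)

(* Defs.v *)
From HB Require Import structures.
From mathcomp Require Import all_boot all_order all_algebra.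
From mathcomp Require Import finmap.
From mathcomp Require Import all_classical all_reals all_analysis.
From mathcomp Require Import measurable_realfun complex spectral.
Import Order.TTheory GRing.Theory Num.Theory.
Import numFieldNormedType.Exports.

Set Implicit Arguments.
Unset Strict Implicit.
Unset Printing Implicit Defensive.

Local Open Scope classical_set_scope.
Local Open Scope ring_scope.

(** Sequences indexed by 1, 2, 3, ... are indexed here by nat, starting at 0.
    In particular the letter j of a word stands for the positive integer j.+1,
    and the entry w k of a word w is its (k.+1)-st letter. *)
Definition Omega (R : realType) : Type := nat -> nat.

HB.instance Definition _ (R : realType) := Choice.on (Omega R).
HB.instance Definition _ (R : realType) := isPointed.Build (Omega R) (fun=> 0%N).

Section Omega_metric.
Context {R : realType}.
Implicit Types a b c : Omega R.

(** The least position where a and b differ is the length of their maximal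
    common initial segment. *)
Definition Omega_dist a b : R :=
  if pselect (exists n, a n != b n) is left ab then 2%:R ^- ex_minn ab else 0.

Lemma Omega_dist_lt a b n :
  (Omega_dist a b < 2%:R ^- n) <-> (forall i, (i <= n)%N -> a i = b i).
Proof.
rewrite /Omega_dist; case: pselect => [ab|ab]; last first.
  split=> [_ i _|_]; last by rewrite invr_gt0 exprn_gt0.
  by apply/eqP/negPn/negP => nab; apply: ab; exists i.
case: ex_minnP => m mab min_m.
rewrite ltf_pV2 ?posrE ?exprn_gt0// ltr_eXn2l ?ltr1n//.
split=> [nm i im|eq_ab].
  by apply/eqP/negPn/negP => /min_m; rewrite leqNgt (leq_ltn_trans im nm).
by rewrite ltnNge; apply/negP => /eq_ab /eqP; apply/negP.
Qed.

Lemma Omega_dist_le a b n :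
  (Omega_dist a b <= 2%:R ^- n) <-> (forall i, (i < n)%N -> a i = b i).
Proof.
rewrite /Omega_dist; case: pselect => [ab|ab]; last first.
  split=> [_ i _|_]; last by rewrite invr_ge0 exprn_ge0.
  by apply/eqP/negPn/negP => nab; apply: ab; exists i.
case: ex_minnP => m mab min_m.
rewrite lef_pV2 ?posrE ?exprn_gt0// ler_eXn2l ?ltr1n//.
split=> [nm i im|eq_ab].
  by apply/eqP/negPn/negP => /min_m; rewrite leqNgt (leq_trans im nm).
by rewrite leqNgt; apply/negP => /eq_ab /eqP; apply/negP.
Qed.

Lemma Omega_dist_ge0 a b : 0 <= Omega_dist a b.
Proof.
by rewrite /Omega_dist; case: pselect => // ab; rewrite invr_ge0 exprn_ge0.
Qed.

Lemma Omega_distxx a : Omega_dist a a = 0.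
Proof.
rewrite /Omega_dist; case: pselect => // xx; exfalso.
by case: xx => n; rewrite eqxx.
Qed.

Lemma Omega_dist_eq0 a b : Omega_dist a b = 0 -> a = b.
Proof.
rewrite /Omega_dist; case: pselect => [ab /eqP|ab _].
  by rewrite invr_eq0 expf_eq0 pnatr_eq0 andbF.
by apply/funext => i; apply/eqP/negPn/negP => nab; apply: ab; exists i.
Qed.

Lemma Omega_dist_sym a b : Omega_dist a b = Omega_dist b a.
Proof.
suff le_dist x y : Omega_dist x y <= Omega_dist y x.
  by apply/eqP; rewrite eq_le !le_dist.
rewrite {2}/Omega_dist; case: pselect => [yx|yx].
  apply/Omega_dist_le => i; case: ex_minnP => m _ min_m im.
  apply/eqP/negPn/negP; rewrite eq_sym => /min_m.
  by rewrite leqNgt im.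
have -> : x = y; last by rewrite Omega_distxx.
apply/funext => i; apply/eqP/negPn/negP => nxy.
by apply: yx; exists i; rewrite eq_sym.
Qed.

Lemma Omega_dist_triangle b a c :
  Omega_dist a c <= Omega_dist a b + Omega_dist b c.
Proof.
suff : Omega_dist a c <= Num.max (Omega_dist a b) (Omega_dist b c).
  by move/le_trans; apply; rewrite ge_max lerDl lerDr !Omega_dist_ge0.
rewrite leNgt gt_max; apply/negP.
rewrite {2 4}/Omega_dist; case: pselect => [h|h]; last first.
  by rewrite ltNge Omega_dist_ge0.
case: ex_minnP => m mac _ /andP[/Omega_dist_lt ab /Omega_dist_lt bc].
by move: mac; rewrite ab// bc// eqxx.
Qed.

End Omega_metric.

HB.instance Definition _ (R : realType) := isMetric.Build R (Omega R)
  Omega_distxx Omega_dist_eq0 Omega_dist_sym Omega_dist_triangle.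

Definition borel_Omega (R : realType) := g_sigma_algebraType (@open (Omega R)).

Section spectral_random_measures.
Context {R : realType}.

(** cexp t = exp(2 pi i t) *)
Definition cexp (t : R) : R[i] := Complex (cos (2 * pi * t)) (sin (2 * pi * t)).

Definition cintegral (nu : {measure set R -> \bar R}) (f : R -> R[i]) : R[i] :=
  Complex (\int[nu]_x complex.Re (f x)) (\int[nu]_x complex.Im (f x)).

Definition sqnormL2 (nu : {measure set R -> \bar R}) (f : R -> R[i]) : \bar R :=
  (\int[nu]_x (Normc.normc (f x) ^+ 2)%:E)%E.

Definition inL2 (nu : {measure set R -> \bar R}) (f : R -> R[i]) : Prop :=
  [/\ measurable_fun [set: R] (fun x : R => complex.Re (f x) : R),
      measurable_fun [set: R] (fun x : R => complex.Im (f x) : R) &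
      (sqnormL2 nu f < +oo)%E].

Definition dotL2 (nu : {measure set R -> \bar R}) (f g : R -> R[i]) : R[i] :=
  cintegral nu (fun x => f x * (g x)^*).

(** The family (e l), l in Lam, is an orthonormal basis of L^2(nu): it is
    orthonormal and its linear span is dense. *)
Definition orthonormal_basisL2 (nu : {measure set R -> \bar R})
    (Lam : set R) (e : R -> R -> R[i]) : Prop :=
  [/\ forall l, Lam l -> inL2 nu (e l),
      forall l l', Lam l -> Lam l' -> dotL2 nu (e l) (e l') = (l == l')%:R &
      forall f, inL2 nu f -> forall eps : R, 0 < eps ->
        exists (s : {fset R}) (c : R -> R[i]),
          [set` s] `<=` Lam /\
          (sqnormL2 nu (fun x => f x - \sum_(l <- s) c l * e l x)%R < eps%:E)%E].

Definition spectral_measure (nu : {measure set R -> \bar R}) : Prop :=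
  nu [set: R] = 1%E /\
  exists Lam : set R, orthonormal_basisL2 nu Lam (fun l x => cexp (l * x)).

(** That M w is a measure for every w is part of the type of M. *)
Definition random_measure (M : Omega R -> {measure set R -> \bar R}) : Prop :=
  forall A : set R, measurable A ->
    measurable_fun [set: borel_Omega R] (fun w : borel_Omega R => M w A).

Definition spectral_random_measure (M : Omega R -> {measure set R -> \bar R}) :
    Prop :=
  random_measure M /\ forall w, spectral_measure (M w).

Definition admissible_pair (N : nat) (B : {fset int}) : Prop :=
  [/\ (2 <= N)%N, (2 <= #|` B|)%N &
      exists2 L : {fset int}, #|` L| = #|` B| &
        \matrix_(i < #|` B|, j < #|` L|)
           ((Num.sqrt #|` B|%:R)^-1%:C%C *
            cexp (- (nth 0 B i * nth 0 L j)%:~R / N%:R)) \is unitarymx].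

Definition tight (Psi : set (probability R R)) : Prop :=
  forall eps : R, 0 < eps -> exists2 K : set R, compact K &
    (1 - eps%:E < ereal_inf [set nu K | nu in Psi])%E.

Definition weak_cvg (mu : nat -> {measure set R -> \bar R})
    (nu : {measure set R -> \bar R}) : Prop :=
  forall f : R -> R, continuous f -> bounded_fun f ->
    (fun k => \int[mu k]_x f x) @ \oo --> \int[nu]_x f x.

End spectral_random_measures.

Section uniform_measure.
Context {R : realType}.

Definition uniform_on (A : {fset R}) : set R -> \bar R :=
  mscale ((#|` A|%:R)^-1)%:nng
    (msum (fun i => dirac (nth 0 A i : R)) #|` A|).

HB.instance Definition _ (A : {fset R}) := Measure.on (uniform_on A).

Let uniform_on_fin A : fin_num_fun (uniform_on A).
Proof.
move=> U mU; rewrite /uniform_on /mscale /= fin_numM// /msum sum_fin_num.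
by apply/allP => _ /mapP[i _ ->]; exact: fin_num_measure.
Qed.

HB.instance Definition _ (A : {fset R}) :=
  Measure_isFinite.Build _ _ _ (uniform_on A) (@uniform_on_fin A).

End uniform_measure.

Section convolution.
Context {R : realType}.
Variables mu nu : {finite_measure set R -> \bar R}.

Definition mconv : set R -> \bar R :=
  pushforward (mu \x nu)%E (fun p : R * R => (p.1 + p.2)%R : R).

Let measurable_add : measurable_fun [set: R * R]
  (fun p : R * R => (p.1 + p.2)%R : R).
Proof. exact: measurable_funD. Qed.

Let mconv0 : mconv set0 = 0%E.
Proof. by rewrite /mconv /pushforward preimage_set0 measure0. Qed.

Let mconv_ge0 A : (0 <= mconv A)%E.
Proof. exact: measure_ge0. Qed.

Let mconv_sigma_additive : semi_sigma_additive mconv.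
Proof.
exact: (@measure_semi_sigma_additive _ _ _ (pushforward (mu \x nu)%E _)).
Qed.

HB.instance Definition _ :=
  isMeasure.Build _ _ _ mconv mconv0 mconv_ge0 mconv_sigma_additive.

Let mconv_fin : fin_num_fun mconv.
Proof.
have : ((mu \x nu) ([set: R] `*` [set: R]) < +oo)%E.
  rewrite product_measure1E// -ge0_fin_numE ?mule_ge0//.
  by rewrite fin_numM ?fin_num_measure.
by rewrite setXTT; exact: (@lty_fin_num_fun _ _ _ mconv).
Qed.

HB.instance Definition _ := Measure_isFinite.Build _ _ _ mconv mconv_fin.

End convolution.

Section infinite_convolution.
Context {R : realType}.
Variables (N : nat -> nat) (B : nat -> {fset int}) (n : nat -> nat).

Definition conv_factor (w : Omega R) (k : nat) :
    {finite_measure set R -> \bar R} :=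
  uniform_on [fset (\prod_(j < k.+1) (N (w j))%:R ^- n j) * b%:~R
             | b in B (w k)]%fset.

(** The convolution of the factors of index 0, ..., k. *)
Fixpoint finite_conv (w : Omega R) (k : nat) :
    {finite_measure set R -> \bar R} :=
  if k is k'.+1 then mconv (finite_conv w k') (conv_factor w k)
  else conv_factor w 0.

Definition infinite_conv_limits (w : Omega R) : set (probability R R) :=
  [set nu | weak_cvg (finite_conv w) nu].

Definition infinite_conv_exists (w : Omega R) : Prop :=
  exists nu, infinite_conv_limits w nu.

(** The weak limit when it exists; the default value is meaningful only together
    with infinite_conv_exists. *)
Definition infinite_conv (w : Omega R) : probability R R :=
  xget (dirac (0 : R) : probability R R) (infinite_conv_limits w).

End infinite_convolution.

(* Main.v *)
Require Import Defs.
From HB Require Import structures.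
From mathcomp Require Import all_boot all_order all_algebra.
From mathcomp Require Import finmap.
From mathcomp Require Import all_classical all_reals all_analysis.
From mathcomp Require Import measurable_realfun complex spectral.
From mathcomp Require Import ring lra zify.
Import Order.TTheory GRing.Theory Num.Theory.
Import numFieldNormedType.Exports.

(** A word w and exponents n attach to each k the digits B (w k), weighted by
    the product of the N (w j) ^- n j for j <= k. Integrating against the
    level k of the convolution is averaging over the list of all sums of one
    weighted digit from each of the first k + 1 sets
    ([Rintegral_finite_conv]). Everything below is a statement about such
    averages that passes to the limit against bounded continuous functions.

    Comparison with the exponents 1. Digits are nonnegative and the bases are
    at least 2, so the sums increase with the level, and passing from
    exponents 1 to n divides every sum by at least 2 ^ (n 0 - 1)
    ([weight_le]). Hence tightness of the limits for exponents 1 bounds the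
    tails of all levels for all words at once ([uniform_tail_bound]). There
    are two consequences. For any exponents, the distribution functions of the
    levels decrease to a right continuous function with limits 0 and 1, whose
    Stieltjes measure is the infinite convolution ([exists_limit_law]). And if
    n k is large, the part of the sum after the first k digits, rescaled to
    size one, is close to 0 in mean, uniformly in the number of digits
    ([rescaled_tails_near0]).

    Spectrum. Let M k = N (w k) ^ n k and P k = M 0 ... M (k - 1).
    Admissibility provides sets L k of integers, which may be taken in the
    interval [- M k / 2, M k / 2] and to contain 0 ([balanced_Hadamard_set]),
    such that the exponentials with frequencies in L 0 + P 1 L 1 + ... + P (k
    - 1) L (k - 1) are an orthonormal basis for the uniform law on the sums of
    k digits ([spec_orthogonal], [finite_expansion]). The union of these
    nested sets is the spectrum of the limit. Orthogonality is inherited by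
    the limit. For completeness, expand a Lipschitz function f with values in
    the unit interval on the level k, f = sum of the c_t e_t. At a point x + y
    of a later level, where x is a sum of the first k digits and y = z / P k
    the rest, the error is f (x + y) - f x plus the sum of the c_t (1 - e_t y)
    e_t x. The frequencies are at most P k in absolute value, so |1 - e_t y|^2
    is bounded by a multiple of min (1, z), while the sum of the |c_t|^2 is at
    most 1 by Parseval. So the mean square error is at most a constant times
    the mean of min (1, z), which is small when n k is large; this is where
    unboundedness of the exponents enters ([fourier_sum_error]). Clamped
    affine functions are thus in the closed span of the exponentials, and a
    pi-lambda argument extends this to the whole of L^2 ([approximable_L2]).

    Measurability in w. Averages over a level depend on finitely many letters,
    so integrals of continuous functions against the limit are measurable, and
    the same pi-lambda argument gives measurability of the mass of every Borel
    set ([random_measure_weak_limit]). *)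

Set Implicit Arguments.
Unset Strict Implicit.
Unset Printing Implicit Defensive.

Local Open Scope classical_set_scope.
Local Open Scope ring_scope.

(** * Averages over finite lists of sums of digits *)

Section mean.
Context {K : numFieldType} {T : eqType}.
Implicit Types (s : seq T) (g h : T -> K).

(** The average counts repetitions in the list, so that averaging over all
    sums of digits is integration against a convolution even if some sums
    coincide. *)
Definition mean s g : K := (size s)%:R^-1 * \sum_(x <- s) g x.

Lemma eq_mean s g h : {in s, g =1 h} -> mean s g = mean s h.
Proof. by move=> gh; congr (_ * _); apply: eq_big_seq. Qed.

Lemma le_mean s g h : {in s, forall x, g x <= h x} -> mean s g <= mean s h.
Proof.
move=> gh; rewrite ler_wpM2l ?invr_ge0// !big_seq.
by apply: ler_sum => x xs; exact: gh.
Qed.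

Lemma meanD s g h : mean s (fun x => g x + h x) = mean s g + mean s h.
Proof. by rewrite /mean big_split mulrDr. Qed.

Lemma meanZ s c g : mean s (fun x => c * g x) = c * mean s g.
Proof. by rewrite /mean -mulr_sumr mulrCA. Qed.

Lemma meanB s g h : mean s (fun x => g x - h x) = mean s g - mean s h.
Proof. by rewrite /mean sumrB mulrBr. Qed.

Lemma mean_sum (I : Type) (r : seq I) (F : I -> T -> K) s :
  mean s (fun x => \sum_(i <- r) F i x) = \sum_(i <- r) mean s (F i).
Proof. by rewrite /mean exchange_big mulr_sumr. Qed.

Lemma mean_cst s c : (0 < size s)%N -> mean s (fun=> c) = c.
Proof.
move=> s0; rewrite /mean big_const_seq count_predT iter_addr_0
  -[c *+ _]mulr_natl.
by rewrite mulKf// pnatr_eq0 -lt0n.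
Qed.

Lemma mean_ge0 s g : {in s, forall x, 0 <= g x} -> 0 <= mean s g.
Proof.
by move=> g0; rewrite mulr_ge0 ?invr_ge0// big_seq; exact: sumr_ge0.
Qed.

End mean.

(** Averaging over pairs is averaging twice: the discrete Fubini theorem
    behind every later splitting of a sum of digits. *)
Lemma mean_allpairs (K : numFieldType) (T1 T2 T : eqType) (h : T1 -> T2 -> T)
    s t (g : T -> K) :
  mean [seq h x y | x <- s, y <- t] g = mean s (fun x => mean t (g \o h x)).
Proof.
rewrite /mean big_allpairs_dep size_allpairs natrM invfM -mulrA; congr (_ * _).
by rewrite mulr_sumr; apply: eq_bigr.
Qed.

Lemma mean_map (K : numFieldType) (T1 T : eqType) (h : T1 -> T)
    s (g : T -> K) :
  mean [seq h x | x <- s] g = mean s (g \o h).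
Proof. by rewrite /mean big_map size_map. Qed.

Lemma mean_rmorph (K K' : numFieldType) (f : {rmorphism K -> K'}) (T : eqType)
    (s : seq T) (g : T -> K) : f (mean s g) = mean s (f \o g).
Proof. by rewrite /mean rmorphM fmorphV rmorph_nat rmorph_sum. Qed.

Section digit_sums.
Context {R : realType}.
Implicit Types (D : nat -> seq R).

(** With multiplicity: the law of a sum of m independent digits, the i-th one
    uniform in D i, is the uniform law on this list. *)
Fixpoint digit_sums D m : seq R :=
  if m is m'.+1 then [seq x + d | x <- digit_sums D m', d <- D m'] else [:: 0].

Lemma eq_digit_sums D D' m : (forall i, (i < m)%N -> D i = D' i) ->
  digit_sums D m = digit_sums D' m.
Proof.
elim: m => //= m IH DD'; rewrite IH ?DD'// => i im.
by rewrite DD'// (ltn_trans im).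
Qed.

Lemma size_digit_sums_gt0 D m : (forall i, (0 < size (D i))%N) ->
  (0 < size (digit_sums D m))%N.
Proof.
by move=> D0; elim: m => //= m IH; rewrite size_allpairs muln_gt0 IH D0.
Qed.

Lemma mean_digit_sumsS {K : numFieldType} D m (g : R -> K) :
  mean (digit_sums D m.+1) g = mean (digit_sums D m)
    (fun x => mean (D m) (fun d => g (x + d))).
Proof. exact: mean_allpairs. Qed.

Lemma mean_digit_sums0 {K : numFieldType} D (g : R -> K) :
  mean (digit_sums D 0) g = g 0.
Proof. by rewrite /mean /= big_seq1 invr1 mul1r. Qed.

(** The first k digits and the remaining m are independent. *)
Lemma mean_digit_sumsD {K : numFieldType} D k m (g : R -> K) :
  mean (digit_sums D (k + m)) g =
  mean (digit_sums D k) (fun x => mean (digit_sums (fun i => D (k + i)%N) m)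
    (fun y => g (x + y))).
Proof.
elim: m g => [|m IH] g.
  by rewrite addn0; apply: eq_mean => x _; rewrite mean_digit_sums0 addr0.
rewrite addnS mean_digit_sumsS IH; apply: eq_mean => x _;
  rewrite mean_digit_sumsS.
by apply: eq_mean => y _; apply: eq_mean => d _; rewrite addrA.
Qed.

Lemma digit_sums_scale D c m : digit_sums (fun i => [seq c * d | d <- D i]) m =
  [seq c * x | x <- digit_sums D m].
Proof.
elim: m => /= [|m ->]; first by rewrite mulr0.
rewrite allpairs_mapl allpairs_mapr map_allpairs.
by apply: eq_allpairs => // x y; rewrite mulrDr.
Qed.

Lemma digit_sums_ge0 D m : (forall i, {in D i, forall d, 0 <= d}) ->
  {in digit_sums D m, forall x, 0 <= x}.
Proof.
move=> D0; elim: m => /= [x|m IH x]; first by rewrite inE => /eqP ->.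
move=> /allpairsP[[y d]/= [ys dD ->]]; by rewrite addr_ge0 ?(IH y) ?(D0 m).
Qed.

(** Nonnegative digits make the random sums grow with the number of digits, so
    a tail bound for the limit bounds every finite level. *)
Lemma le_mean_digit_sumsS D m (g : R -> R) : {homo g : x y / x <= y} ->
  (forall i, (0 < size (D i))%N) -> (forall i, {in D i, forall d, 0 <= d}) ->
  mean (digit_sums D m) g <= mean (digit_sums D m.+1) g.
Proof.
move=> gnd Ds D0; rewrite mean_digit_sumsS; apply: le_mean => x _.
rewrite -[leLHS](mean_cst _ (Ds m)); apply: le_mean => d dD.
by apply: gnd; rewrite lerDl; exact: (D0 m).
Qed.

(** A coupling: both sums use the same random digits t, and only the weights
    in front of them differ. *)
Lemma le_mean_digit_sums_weights D D' (T : eqType) (b : nat -> seq T)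
  (u v : nat -> T -> R) m
   (g : R -> R) : {homo g : x y / x <= y} ->
   (forall i, {in b i, forall t, u i t <= v i t}) ->
   (forall i, D i = [seq u i t | t <- b i]) ->
   (forall i, D' i = [seq v i t | t <- b i]) ->
  mean (digit_sums D m) g <= mean (digit_sums D' m) g.
Proof.
move=> + uv DE D'E; elim: m g => [|m IH] g gnd;
  first by rewrite !mean_digit_sums0.
rewrite !mean_digit_sumsS; apply: (@le_trans _ _
  (mean (digit_sums D m) (fun x => mean (D' m) (fun d => g (x + d))))).
  apply: le_mean => x _; rewrite DE D'E !mean_map; apply: le_mean => t tb /=.
  by apply: gnd; rewrite lerD2l uv.
apply: IH => x y xy; apply: le_mean => d _.
by apply: gnd; rewrite lerD2r.
Qed.

End digit_sums.

(** * Finite convolutions as averages *)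

Lemma perm_mean (K : numFieldType) (T : eqType) (s t : seq T) (g : T -> K) :
  perm_eq s t -> mean s g = mean t g.
Proof. by move=> st; rewrite /mean (perm_size st) (perm_big _ st). Qed.

Section digits.
Context {R : realType}.
Variables (N : nat -> nat) (B : nat -> {fset int}) (n : nat -> nat).

Definition weight (w : nat -> nat) k : R :=
  \prod_(j < k.+1) (N (w j))%:R ^- n j.

(** The atoms of the k-th factor of the convolution; the prefactors are
    nonzero, so there are as many of them as digits. *)
Definition digits (w : nat -> nat) k : seq R :=
  [seq weight w k * b%:~R | b <- B (w k)].

End digits.

Section finite_conv_factors.
Context {R : realType}.
Local Open Scope ereal_scope.

(** The integral is computed in the extended reals for nonnegative functions,
    where pushforward and Fubini need no integrability. *)
Lemma ge0_integral_uniform_on (A : {fset R}) (g : R -> R) :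
  measurable_fun setT g -> (forall x, (0 <= g x)%R) ->
  \int[uniform_on A]_x (g x)%:E = (mean A g)%:E.
Proof.
move=> /measurable_EFinP mg g0.
rewrite /uniform_on ge0_integral_mscale//=; last by move=> x _; rewrite lee_fin.
rewrite ge0_integral_measure_sum//=; last by move=> x _; rewrite lee_fin.
under eq_bigr do rewrite integral_dirac// diracT mul1e.
by rewrite sumEFin -EFinM /mean (big_nth 0%R) big_mkord.
Qed.

Lemma ge0_integral_mconv (mu nu : {finite_measure set R -> \bar R})
  (g : R -> R) :
  measurable_fun setT g -> (forall x, (0 <= g x)%R) ->
  \int[mconv mu nu]_x (g x)%:E = \int[mu]_x \int[nu]_y (g (x + y))%:E.
Proof.
move=> mg g0.
have madd : measurable_fun [set: R * R] (fun p : R * R => (p.1 + p.2)%R : R).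
  exact: measurable_funD.
rewrite /mconv ge0_integral_pushforward//; last 2 first.
- exact/measurable_EFinP.
- by move=> y _; rewrite lee_fin.
rewrite preimage_setT fubini_tonelli1//.
  by apply/measurable_EFinP; exact: measurableT_comp.
by move=> x; rewrite lee_fin.
Qed.

End finite_conv_factors.

Section finite_conv_as_average.
Context {R : realType}.
Variables (N : nat -> nat) (B : nat -> {fset int}) (n : nat -> nat).
Hypothesis N_gt0 : forall k, (0 < N k)%N.

Lemma weight_gt0 w k : 0 < weight N n w k :> R.
Proof. by apply: prodr_gt0 => j _; rewrite invr_gt0 exprn_gt0// ltr0n. Qed.

Lemma ge0_integral_conv_factor (w : Omega R) k (g : R -> R) :
  measurable_fun setT g -> (forall x, 0 <= g x) ->
  (\int[conv_factor N B n w k]_x (g x)%:E = (mean (digits N B n w k) g)%:E)%E.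
Proof.
move=> mg g0; rewrite /conv_factor ge0_integral_uniform_on//; congr EFin.
apply: perm_mean; apply: (perm_trans (enum_imfset _ _)) => //.
move=> x y _ _ /(mulfI _) xy; apply: (@intr_inj R); apply: xy.
exact: lt0r_neq0 (weight_gt0 w k).
Qed.

Lemma measurable_mean (s : seq R) (g : R -> R) : measurable_fun setT g ->
  measurable_fun [set: R] (fun x => mean s (fun y => g (x + y))).
Proof.
move=> mg; apply: measurable_funM => //; apply: measurable_sum => y.
by apply: measurableT_comp => //; exact: measurable_funD.
Qed.

Lemma ge0_integral_finite_conv (w : Omega R) k (g : R -> R) :
  measurable_fun setT g -> (forall x, 0 <= g x) ->
  (\int[finite_conv N B n w k]_x (g x)%:E =
   (mean (digit_sums (digits N B n w) k.+1) g)%:E)%E.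
Proof.
elim: k g => [|k IH] g mg g0.
  rewrite ge0_integral_conv_factor// mean_digit_sumsS mean_digit_sums0;
    congr EFin.
  by apply: eq_mean => x _; rewrite add0r.
rewrite ge0_integral_mconv//.
rewrite (eq_integral (fun x : R =>
    (mean (digits N B n w k.+1) (fun d => g (x + d)))%:E)); last first.
  move=> x _; rewrite (@ge0_integral_conv_factor w k.+1 (fun d => g (x + d)))//.
  by apply: measurableT_comp => //; exact: measurable_funD.
rewrite mean_digit_sumsS -IH//; first exact: measurable_mean.
by move=> x; apply: mean_ge0.
Qed.

(** From here on the finite convolutions are replaced by averages over lists
    of real numbers. *)
Lemma Rintegral_finite_conv (w : Omega R) k (g : R -> R) :
  measurable_fun setT g ->
  \int[finite_conv N B n w k]_x g x = mean (digit_sums (digits N B n w) k.+1) g.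
Proof.
move=> mg; rewrite /Rintegral integralE.
rewrite (eq_integral (EFin \o g^\+)); last by move=> x _;
  rewrite funeposE /= EFin_max.
rewrite [X in (_ - X)%E](eq_integral (EFin \o g^\-)); last first.
  by move=> x _; rewrite funenegE /= EFin_max.
rewrite (@ge0_integral_finite_conv w k g^\+)//; [|exact: measurable_funrpos].
rewrite (@ge0_integral_finite_conv w k g^\-)//; [|exact: measurable_funrneg].
rewrite -EFinB [LHS]/= -meanB; apply: eq_mean => x _.
by rewrite -[in RHS](funrposBneg g).
Qed.

End finite_conv_as_average.

(** * Bounded measurable functions and step functions *)

Section bounded_measurable.
Context d (T : measurableType d) (R : realType) (nu : probability T R).
Implicit Types f g : T -> R.

(** A class of functions, closed under the ring operations, on which
    integration against a probability measure is linear without side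
    conditions on integrability. *)
Definition bmeasurable f := measurable_fun [set: T] f /\ exists K : R, forall x,
  `|f x| <= K.

Lemma bmeasurable_integrable f : bmeasurable f ->
  nu.-integrable setT (EFin \o f).
Proof.
move=> [mf [K fK]]; apply: measurable_bounded_integrable => //.
- exact: (le_lt_trans (probability_le1 nu measurableT) (ltry 1)).
- by exists K; split;
  [exact: num_real|move=> r Kr x _ /=; exact: le_trans (fK x) (ltW Kr)].
Qed.

Lemma bmeasurableD f g : bmeasurable f -> bmeasurable g ->
  bmeasurable (fun x => f x + g x).
Proof.
move=> [mf [K fK]] [mg [L gL]]; split; first exact: measurable_funD.
by exists (K + L) => x; rewrite (le_trans (ler_normD _ _))// lerD.
Qed.

Lemma bmeasurableM f g : bmeasurable f -> bmeasurable g ->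
  bmeasurable (fun x => f x * g x).
Proof.
move=> [mf [K fK]] [mg [L gL]]; split; first exact: measurable_funM.
by exists (K * L) => x; rewrite normrM ler_pM.
Qed.

Lemma bmeasurable_cst c : bmeasurable (fun=> c).
Proof. by split=> //; exists `|c|. Qed.

Lemma bmeasurableZ c f : bmeasurable f -> bmeasurable (fun x => c * f x).
Proof. by move=> bf; apply: bmeasurableM => //; exact: bmeasurable_cst. Qed.

Lemma bmeasurableB f g : bmeasurable f -> bmeasurable g ->
  bmeasurable (fun x => f x - g x).
Proof.
move=> [mf [K fK]] [mg [L gL]]; split; first exact: measurable_funB.
by exists (K + L) => x; rewrite (le_trans (ler_normB _ _))// lerD.
Qed.

Lemma bmeasurable_sum (I : Type) (r : seq I) (F : I -> T -> R) :
  (forall i, bmeasurable (F i)) -> bmeasurable (fun x => \sum_(i <- r) F i x).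
Proof.
move=> bF; elim: r => [|i r IH].
  by rewrite [X in bmeasurable X](_ : _ = fun=> 0);
    [exact: bmeasurable_cst|apply/funext => x; rewrite big_nil].
rewrite [X in bmeasurable X](_ : _ = fun x => F i x + \sum_(i <- r) F i x).
  exact: bmeasurableD.
by apply/funext => x; rewrite big_cons.
Qed.

Lemma bmeasurable_norm f : bmeasurable f -> bmeasurable (fun x => `|f x|).
Proof.
move=> [mf [K fK]]; split; first exact: measurableT_comp.
by exists K => x; rewrite normr_id.
Qed.

Lemma Rint_sum (I : Type) (r : seq I) (F : I -> T -> R) :
  (forall i, bmeasurable (F i)) ->
  \int[nu]_x (\sum_(i <- r) F i x) = \sum_(i <- r) \int[nu]_x F i x.
Proof.
move=> bF; elim: r => [|i r IH].
  rewrite big_nil -[RHS](mul0r (fine (nu setT))) -Rintegral_cst//.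
  by apply: eq_Rintegral => x _; rewrite big_nil.
rewrite big_cons -IH -RintegralD//; last 2 first.
- exact: bmeasurable_integrable.
- by apply: bmeasurable_integrable; exact: bmeasurable_sum.
by apply: eq_Rintegral => x _; rewrite big_cons.
Qed.

Lemma Rint_cst c : \int[nu]_x c = c.
Proof.
rewrite Rintegral_cst// (_ : (nu : {measure set T -> \bar R}) _ = 1%E) ?mulr1//.
exact: probability_setT.
Qed.

Lemma le_Rint f g : bmeasurable f -> bmeasurable g -> (forall x, f x <= g x) ->
  \int[nu]_x f x <= \int[nu]_x g x.
Proof.
by move=> bf bg fg; apply: le_Rintegral => //; exact: bmeasurable_integrable.
Qed.

Lemma RintD f g : bmeasurable f -> bmeasurable g ->
  \int[nu]_x (f x + g x) = \int[nu]_x f x + \int[nu]_x g x.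
Proof.
by move=> bf bg; apply: RintegralD => //; exact: bmeasurable_integrable.
Qed.

Lemma RintB f g : bmeasurable f -> bmeasurable g ->
  \int[nu]_x (f x - g x) = \int[nu]_x f x - \int[nu]_x g x.
Proof.
by move=> bf bg; apply: RintegralB => //; exact: bmeasurable_integrable.
Qed.

Lemma RintZ c f : bmeasurable f ->
  \int[nu]_x (c * f x) = c * \int[nu]_x f x.
Proof.
by move=> bf; apply: RintegralZl => //; exact: bmeasurable_integrable.
Qed.

Lemma bmeasurable_indic A : measurable A -> bmeasurable (\1_A).
Proof.
move=> mA; split; first exact: measurable_indic.
by exists 1 => x; rewrite indicE normr_nat lern1 leq_b1.
Qed.

Lemma Rint_indic A : measurable A -> \int[nu]_x \1_A x = fine (nu A).
Proof. by move=> mA; rewrite /Rintegral integral_indic// setIT. Qed.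

End bounded_measurable.

Section step_functions.
Context {R : realType}.

(** The Heine-Cantor theorem, with the second point allowed to leave the
    compact set. *)
Lemma uniformly_continuous_on_compact (K : set R) (f : R -> R) : compact K ->
  continuous f ->
  forall e, 0 < e -> exists2 d, 0 < d & forall x, K x -> forall y,
    `|x - y| < d -> `|f x - f y| < e.
Proof.
move=> /compact_near_coveringP cK cf e e0.
have := @cK R (0 : R)^'+ (fun h x => forall y, `|x - y| < h ->
  `|f x - f y| < e) _.
case.
  move=> x Kx.
  have /cvgrPdist_lt/(_ _ (divr_gt0 e0 (ltr0Sn _ 1))) := cf x.
  rewrite -nbhs_ballE => -[/= d d0 dP].
  exists (ball x (d / 2), [set h | h < d / 2]) => /=.
    split; first by apply: nbhsx_ballx; rewrite divr_gt0.
    by apply: nbhs_right_lt; rewrite divr_gt0.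
  move=> [x' h]/= [xx' hd] y yh.
  have d1 : `|f x - f x'| < e / 2.
    by apply: dP; apply: le_ball xx'; rewrite ler_pdivrMr// ler_pMr// ler1n.
  have d2 : `|f x - f y| < e / 2.
    apply: dP; rewrite /ball/= -(subrKA x').
    rewrite (le_lt_trans (ler_normD _ _))// [ltRHS](splitr d) ltrD//.
    exact: lt_trans hd.
  rewrite -(subrKA (f x)) (le_lt_trans (ler_normD _ _))//.
  by rewrite [ltRHS](splitr e) distrC ltrD.
move=> h /= h0 hP; exists (h / 2); first by rewrite divr_gt0.
by apply: hP => /=;
  rewrite ?divr_gt0// sub0r normrN gtr0_norm ?divr_gt0// ltr_pdivrMr// ltr_pMr//
  ltr1n.
Qed.

(** The interval from a to b is cut into p pieces so short that f varies by at
    most e on each, and f is replaced on each piece by its value at the right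
    end; the step function vanishes off the interval, which costs K there.
    Writing it with the indicators of half-lines makes its averages linear
    combinations of values of distribution functions. *)
Lemma step_approx (f : R -> R) (K e a b : R) : continuous f ->
  (forall x, `|f x| <= K) ->
  0 < e -> a < b -> exists (p : nat) (c t : nat -> R), forall x : R,
  `|f x - \sum_(i < p) c i * ((x <= t i.+1)%R%:R - (x <= t i)%R%:R)|
    <= e + K * ((x <= a)%R%:R + (1 - (x <= b)%R%:R)).
Proof.
move=> cf fK e0 ab.
have K0 : 0 <= K := le_trans (normr_ge0 _) (fK 0).
have [d d0 dP] := uniformly_continuous_on_compact (@segment_compact _ a b) cf
  e0.
have [p p0 pd] : exists2 p, (0 < p)%N & (b - a) / p%:R < d.
  exists (Num.truncn ((b - a) / d)).+1 => //.
  rewrite ltr_pdivrMr ?ltr0n// mulrC -ltr_pdivrMr//.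
  by rewrite truncnS_gt.
pose h := (b - a) / p%:R.
have h0 : 0 < h by rewrite divr_gt0 ?subr_gt0 ?ltr0n.
pose t i := a + i%:R * h.
have t_le i j : (i <= j)%N -> t i <= t j.
  by move=> ij; rewrite lerD2l ler_wpM2r ?ler_nat// ltW.
have tp : t p = b.
  by rewrite /t /h mulrC divfK ?pnatr_eq0 -?lt0n// addrC subrK.
exists p, (fun i => f (t i.+1)), t => x.
have [xa|ax] := leP x a.
  rewrite (_ : (x <= b) = true); last exact: le_trans xa (ltW ab).
  rewrite big1 ?subr0 ?subrr ?addr0 ?mulr1; last first.
    move=> i _; have xt j : (x <= t j) = true.
      by apply: le_trans xa _; rewrite lerDl mulr_ge0// ltW.
    by rewrite !xt subrr mulr0.
  by rewrite (le_trans (fK x))// lerDr ltW.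
have [xb|bx] := leP x b; last first.
  rewrite big1 ?subr0 1?[X in _ * X]subr0 ?add0r ?mulr1; last first.
    move=> i _; have xt j : (j <= p)%N -> (x <= t j) = false.
      by move=> jp; rewrite leNgt (le_lt_trans _ bx)// -tp; exact: t_le.
    by rewrite !xt ?subrr ?mulr0// ltnW.
  by rewrite (le_trans (fK x))// lerDr ltW.
rewrite subrr addr0 mulr0 addr0.
have ex : exists i, x <= t i by exists p; rewrite tp.
case: (ex_minnP ex) => -[|j] xj jmin.
  by move: xj; rewrite /t mul0r addr0 leNgt ax.
have jp : (j < p)%N by apply: jmin; rewrite tp.
have tjx : t j < x.
  by rewrite ltNge; apply/negP => /jmin; rewrite ltnn.
rewrite (bigD1 (Ordinal jp))//= big1 => [|i].
  rewrite xj (leNgt x) tjx subr0 mulr1 addr0 ltW//.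
  apply: dP; first by rewrite /= in_itv/= (ltW ax) xb.
  rewrite distrC ger0_norm ?subr_ge0//; apply: le_lt_trans pd.
  have -> : t j.+1 = t j + h by rewrite /t -natr1 mulrDl mul1r addrA.
  by rewrite -/h; move: (ltW tjx); lra.
rewrite -val_eqE/= neq_ltn => /orP[ij|ji].
  rewrite !(leNgt x) (le_lt_trans (t_le _ _ ij) tjx).
  by rewrite (le_lt_trans (t_le _ _ (ltnW ij)) tjx) subrr mulr0.
by rewrite (le_trans xj (t_le _ _ ji)) (le_trans xj (t_le _ _ (ltnW _)))// subrr
  mulr0.
Qed.

End step_functions.

(** * Weak convergence from distribution functions *)

Lemma bounded_fun_boundP (T : Type) (R : realType) (f : T -> R) :
  bounded_fun f <-> exists K, forall x, `|f x| <= K.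
Proof.
split=> [[M [_ MP]]|[K fK]].
  by exists (M + 1) => x; apply: (MP (M + 1)) => //; rewrite ltrDl.
by exists K; split;
  [exact: num_real|move=> r Kr x _; exact: le_trans (fK x) (ltW Kr)].
Qed.

Lemma bmeasurable_continuous (R : realType) (f : R -> R) :
  continuous f -> bounded_fun f -> bmeasurable f.
Proof.
move=> cf /bounded_fun_boundP bf; split=> //; exact: continuous_measurable_fun.
Qed.

Lemma ler_norm_mean (K : numFieldType) (T : eqType) (s : seq T) (g : T -> K) :
  `|mean s g| <= mean s (fun x => `|g x|).
Proof.
rewrite /mean normrM normfV normr_nat ler_wpM2l ?invr_ge0//.
exact: ler_norm_sum.
Qed.

Section cdf_convergence.
Context {R : realType}.

(** The distribution function of the uniform law on the list s. *)
Definition mean_cdf (s : seq R) (x : R) : R := mean s (fun y => (y <= x)%R%:R).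

Lemma mean_cdf_ge0 s x : 0 <= mean_cdf s x.
Proof. by apply: mean_ge0. Qed.

Lemma mean_cdf_le1 s x : (0 < size s)%N -> mean_cdf s x <= 1.
Proof.
move=> s0; rewrite -(mean_cst 1 s0); apply: le_mean => y _.
by rewrite lern1 leq_b1.
Qed.

Lemma le_mean_cdf s x y : x <= y -> mean_cdf s x <= mean_cdf s y.
Proof.
move=> xy; apply: le_mean => z _; rewrite ler_nat.
by case: (leP z x) => // zx; rewrite (le_trans zx xy).
Qed.

Variables (s : nat -> seq R) (G : R -> R) (nu : probability R R).
Hypothesis s_gt0 : forall m, (0 < size (s m))%N.
Hypothesis nuG : forall x : R, nu `]-oo, x]%classic = (G x)%:E.
Hypothesis sG : forall x, (fun m => mean_cdf (s m) x) @ \oo --> G x.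
Hypothesis tails : forall e, 0 < e -> exists a b, a < b /\
  forall m, mean_cdf (s m) a <= e /\ 1 - mean_cdf (s m) b <= e.

Let bmeasurable_ray x : bmeasurable (fun y : R => (y <= x)%R%:R : R).
Proof.
have := @bmeasurable_indic _ R R `]-oo, x]%classic (measurable_itv _).
congr bmeasurable; apply/funext => y; rewrite indicE.
by rewrite mem_setE in_itv.
Qed.

Let Rint_ray x : \int[nu]_y ((y <= x)%R%:R) = G x.
Proof.
rewrite -[RHS]/(fine (G x)%:E) -nuG -Rint_indic//; apply: eq_Rintegral => y _.
by rewrite indicE mem_setE in_itv.
Qed.

(** The easy half of the Helly-Bray theorem: the distribution functions
    converge everywhere and no mass escapes, so a step function close to f
    transfers the convergence to f. *)
Lemma cvg_mean_cdf (f : R -> R) : continuous f -> bounded_fun f ->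
  (fun m => mean (s m) f) @ \oo --> \int[nu]_x f x.
Proof.
move=> cf bf; have [K fK] := (bounded_fun_boundP f).1 bf.
have mf := bmeasurable_continuous cf bf.
have K0 : 0 <= K := le_trans (normr_ge0 _) (fK 0).
apply/cvgrPdist_lt => e e0.
(* The function f is within d + K (d + d) of the step function in both means,
   and the two means of the step function are within d, which adds up to 3 d +
   4 K d < e. *)
pose d := e / (5 + 4 * K).
have d0 : 0 < d by rewrite divr_gt0//; lra.
have [a [b [ab abP]]] := tails d0.
have [p [c [t gP]]] := step_approx cf fK d0 ab.
pose g x : R := \sum_(i < p) c i * ((x <= t i.+1)%R%:R - (x <= t i)%R%:R).
have bg : bmeasurable g.
  apply: bmeasurable_sum => i; apply: bmeasurableZ; apply: bmeasurableB;
    exact: bmeasurable_ray.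
pose r x : R := d + K * ((x <= a)%R%:R + (1 - (x <= b)%R%:R)).
have br : bmeasurable r.
  apply: bmeasurableD; first exact: bmeasurable_cst.
  apply: bmeasurableZ; apply: bmeasurableD => //; apply: bmeasurableB => //;
    exact: bmeasurable_cst.
have meang m : mean (s m) g =
    \sum_(i < p) c i * (mean_cdf (s m) (t i.+1) - mean_cdf (s m) (t i)).
  by rewrite mean_sum; apply: eq_bigr => i _; rewrite meanZ meanB.
have intg : \int[nu]_x g x = \sum_(i < p) c i * (G (t i.+1) - G (t i)).
  rewrite Rint_sum => [|i].
    apply: eq_bigr => i _; rewrite RintZ ?RintB ?Rint_ray//.
    by apply: bmeasurableB; exact: bmeasurable_ray.
  by apply: bmeasurableZ; apply: bmeasurableB; exact: bmeasurable_ray.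
have gcvg : (fun m => mean (s m) g) @ \oo --> \int[nu]_x g x.
  rewrite intg (_ : (fun m => _) = (fun m =>
    \sum_(i < p) c i * (mean_cdf (s m) (t i.+1) - mean_cdf (s m) (t i))));
      last first.
    by apply/funext => m; rewrite meang.
  apply: cvg_big => [|i _].
    exact: add_continuous.
  by apply: cvgM; [exact: cvg_cst|apply: cvgB; exact: sG].
have meanr m : mean (s m) r <= d + K * (d + d).
  rewrite meanD (mean_cst _ (s_gt0 m)) meanZ lerD2l ler_wpM2l// meanD meanB.
  by rewrite (mean_cst _ (s_gt0 m)) lerD//; case: (abP m).
have intr : \int[nu]_x r x <= d + K * (d + d).
  have ray c' : bmeasurable (fun y : R => (y <= c')%R%:R : R) :=
    bmeasurable_ray c'.
  have b1 : bmeasurable (fun _ : R => 1 : R) by exact: bmeasurable_cst.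
  have bb : bmeasurable (fun y : R => 1 - (y <= b)%R%:R : R)
    by exact: bmeasurableB.
  have bab : bmeasurable (fun y : R => (y <= a)%R%:R + (1 - (y <= b)%R%:R) : R)
    by exact: bmeasurableD.
  rewrite RintD//; [|exact: bmeasurable_cst|exact: bmeasurableZ].
  rewrite Rint_cst RintZ// lerD2l ler_wpM2l// RintD// RintB// Rint_cst
    !Rint_ray.
  apply: lerD.
    rewrite -(cvg_lim _ (@sG a))//; apply: limr_le; first by apply: cvgP;
      exact: sG.
    by near=> m; case: (abP m).
  rewrite lerBlDr -lerBlDl -(cvg_lim _ (@sG b))//; apply: limr_ge.
    by apply: cvgP; exact: sG.
  by near=> m; rewrite lerBlDl -lerBlDr; case: (abP m).
have dist_mean m : `|mean (s m) f - mean (s m) g| <= d + K * (d + d).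
  rewrite -meanB (le_trans (ler_norm_mean _ _))// (le_trans _ (meanr m))//.
  by apply: le_mean => x _; exact: gP.
have dist_int : `|\int[nu]_x f x - \int[nu]_x g x| <= d + K * (d + d).
  rewrite -RintB// (le_trans (le_normr_Rintegral _ _))//.
    by apply: bmeasurable_integrable; exact: bmeasurableB.
  rewrite (le_trans _ intr)//; apply: le_Rint => //.
  by apply: bmeasurable_norm; exact: bmeasurableB.
move/cvgrPdist_lt : gcvg => /(_ _ d0) gcvg; near=> m.
have gm : `|\int[nu]_x g x - mean (s m) g| < d by near: m; exact: gcvg.
have eE : e = d * 5 + d * 4 * K.
  by rewrite -mulrA -mulrDr divfK//; lra.
have dK : 0 <= d * K by rewrite mulr_ge0// ltW.
rewrite -(subrKA (\int[nu]_x g x)) (le_lt_trans (ler_normD _ _))//.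
rewrite -[X in `|_| + `|X|](subrKA (mean (s m) g)).
apply: (@le_lt_trans _ _ ((d + K * (d + d)) + (d + (d + K * (d + d))))).
  apply: lerD => //; rewrite (le_trans (ler_normD _ _))//.
  by apply: lerD; [exact: ltW|rewrite distrC; exact: dist_mean].
by rewrite eE; lra.
Unshelve. all: by end_near. Qed.

End cdf_convergence.

(** * Existence of the limit law *)

(** A finite set has no point just to the right of x. *)
Lemma mean_cdf_right_locally_constant (R : realType) (s : seq R) (x : R) :
  \forall y \near x^'+, mean_cdf s y = mean_cdf s x.
Proof.
have : \forall y \near x^'+, forall z, z \in s -> (z <= y) = (z <= x).
  elim: s => [|z s IH]; first by near=> y.
  have zP : \forall y \near x^'+, (z <= y) = (z <= x).
    have [zx|xz] := leP z x.
      by near=> y; rewrite (le_trans zx)//; near: y; exact: nbhs_right_ge.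
    by near=> y; apply/negbTE; rewrite -ltNge; near: y; exact: nbhs_right_lt.
  near=> y => u; rewrite inE => /predU1P[->{u}|]; first by near: y.
  by move: u; near: y.
move=> sP; near=> y; apply: eq_mean => z zs; congr (nat_of_bool _)%:R.
by move: z zs; near: y.
Unshelve. all: by end_near. Qed.

Section limit_law.
Context {R : realType}.
Variable D : nat -> seq R.
Hypothesis D_gt0 : forall i, (0 < size (D i))%N.
Hypothesis D_ge0 : forall i, {in D i, forall d, 0 <= d}.
Hypothesis D_tail : forall e : R, 0 < e -> exists C, forall m,
  1 - mean_cdf (digit_sums D m) C <= e.

Let F m x := mean_cdf (digit_sums D m) x.

Let G x := limn (F ^~ x).

Let F_nincr x : nonincreasing_seq (F ^~ x).
Proof.
apply/nonincreasing_seqP => m.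
have nd : {homo (fun y : R => - (y <= x)%R%:R : R) : y z / y <= z}.
  move=> y z yz; rewrite lerN2 ler_nat.
  by case: (leP z x) => // zx; rewrite (le_trans yz zx).
have := @le_mean_digit_sumsS _ D m _ nd D_gt0 D_ge0.
under eq_mean do rewrite -mulN1r.
under [X in _ <= X -> _]eq_mean do rewrite -mulN1r.
by rewrite !meanZ !mulN1r lerN2.
Qed.

Let F_cvg x : F ^~ x @ \oo --> G x.
Proof.
suff : cvgn (F ^~ x) by [].
apply: nonincreasing_is_cvgn => //.
by exists 0 => _ [m _ <-]; exact: mean_cdf_ge0.
Qed.

Let G_le m x : G x <= F m x.
Proof. exact: nonincreasing_cvgn_ge. Qed.

Let G_nd : nondecreasing G.
Proof.
move=> x y xy; apply: ler_lim; [exact: F_cvg|exact: F_cvg|].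
by near=> m; exact: le_mean_cdf.
Unshelve. all: by end_near. Qed.

Let G_ge0 x : 0 <= G x.
Proof.
apply: limr_ge; first exact: F_cvg.
by near=> m; exact: mean_cdf_ge0.
Unshelve. all: by end_near. Qed.

Let G_le1 x : G x <= 1.
Proof.
by rewrite (le_trans (G_le 0 x))// mean_cdf_le1// size_digit_sums_gt0.
Qed.

(** A decreasing limit of nondecreasing right-continuous functions is right-
    continuous: just to the right of x, G stays below some F m that is close
    to G x at x. Hence G is itself a distribution function. *)
Let G_rc : right_continuous G.
Proof.
move=> x; apply/cvgrPdist_lt => e e0.
have /cvgrPdist_lt/(_ _ e0)[m _ /(_ m (leqnn m))/= Gm] := @F_cvg x.
near=> y.
have xy : x < y by near: y; exact: nbhs_right_gt.
rewrite distrC ger0_norm ?subr_ge0; last exact: G_nd (ltW xy).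
apply: (@le_lt_trans _ _ (F m x - G x)).
  rewrite lerB// (le_trans (G_le m y))// le_eqVlt; apply/orP; left; apply/eqP.
  near: y; exact: mean_cdf_right_locally_constant.
by rewrite -(ger0_norm (_ : 0 <= F m x - G x)) ?subr_ge0// distrC.
Unshelve. all: by end_near. Qed.

Let F_neg m x : x < 0 -> F m x = 0.
Proof.
move=> x0; rewrite /F /mean_cdf /mean big_seq big1 ?mulr0// => y ys.
by rewrite leNgt (lt_le_trans x0)// (digit_sums_ge0 D_ge0 ys).
Qed.

Let G_neg x : x < 0 -> G x = 0.
Proof. by move=> x0; apply: le_anti; rewrite G_ge0 -(F_neg 0 x0) G_le. Qed.

Let G_Ny : G @ -oo --> (0 : R).
Proof.
apply: cvg_near_cst; near=> x; apply: G_neg; near: x; exact: nbhs_ninfty_lt.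
Unshelve. all: by end_near. Qed.

Let G_y : G @ +oo --> (1 : R).
Proof.
apply/cvgrPdist_le => e e0; have [C CP] := D_tail e0; near=> x.
rewrite ger0_norm ?subr_ge0// (@le_trans _ _ (1 - G C))//.
  by rewrite lerB// G_nd//; near: x; exact: nbhs_pinfty_ge.
rewrite lerBlDr -lerBlDl; apply: limr_ge; first exact: F_cvg.
by near=> m; rewrite lerBlDl -lerBlDr; exact: CP.
Unshelve. all: by end_near. Qed.

HB.instance Definition _ := isCumulative.Build R _ R G G_nd G_rc.
HB.instance Definition _ := isCumulativeBounded.Build R 0 1 G G_Ny G_y.

Let idTR : measurableTypeR R -> R := idfun.

#[local] HB.instance Definition _ :=
  @isMeasurableFun.Build _ _ _ _ idTR (@measurable_id _ _ setT).

Let lsG := lebesgue_stieltjes_measure G.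

Let nu := distribution lsG (idTR : {RV lsG >-> R}).

(** The sums grow with m, so their distribution functions decrease, and the
    tail condition keeps the limit from losing mass at infinity; the Stieltjes
    measure of the limit is the limit law. *)
Lemma exists_limit_law : exists nu : probability R R, forall f : R -> R,
  continuous f -> bounded_fun f ->
  (fun m => mean (digit_sums D m) f) @ \oo --> \int[nu]_x f x.
Proof.
exists (nu : probability R R) => f cf bf;
  apply: (@cvg_mean_cdf _ (digit_sums D) G) => //.
- by move=> m; exact: size_digit_sums_gt0.
- move=> x; exact: (cdf_lebesgue_stieltjes_id G x).
move=> e e0; have [C CP] := D_tail e0; exists (-1), (`|C| + 1).
split; first by rewrite (@lt_le_trans _ _ 0)// addr_ge0.
move=> m; split; first by rewrite [mean_cdf _ _]F_neg ?ltW.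
rewrite (le_trans _ (CP m))// lerB// le_mean_cdf//.
by rewrite (le_trans (ler_norm _))// lerDl.
Qed.

End limit_law.

(** * Tightness and comparison of exponents *)

Section clamp.
Context {R : realType}.
Implicit Types x y : R.

(** Truncation to the unit interval. It serves as a test function in three
    ways: its averages measure how far nonnegative sums are from 0, it bounds
    moduli of continuity, and the ramps clamp (c + r * x) approximate
    indicators of half-lines. *)
Definition clamp x : R := Num.min 1 (Num.max 0 x).

Lemma clamp_nd : {homo clamp : x y / x <= y}.
Proof. by move=> x y xy; rewrite le_min2// le_max2. Qed.

Lemma clamp_ge0 x : 0 <= clamp x.
Proof. by rewrite le_min ler01 le_max lexx. Qed.

Lemma clamp_le1 x : clamp x <= 1.
Proof. by rewrite ge_min lexx. Qed.

Lemma clamp_le x : 0 <= x -> clamp x <= x.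
Proof. by move=> x0; rewrite ge_min [X in _ || X]ge_max x0 lexx orbT. Qed.

Lemma clamp_eq1 x : 1 <= x -> clamp x = 1.
Proof.
move=> x1; rewrite /clamp max_r ?(le_trans ler01)//.
by rewrite min_l.
Qed.

Lemma continuous_clamp : continuous clamp.
Proof.
move=> x.
have c0 (c : R) : {for x, continuous (cst c : R -> R^o)} by exact: cvg_cst.
have cid : {for x, continuous (idfun : R -> R^o)} by exact: cvg_id.
exact: (continuous_min (c0 1) (continuous_max (c0 0) cid)).
Qed.

Lemma continuous_clamp_affine c r : continuous (fun x => clamp (c + r * x)).
Proof.
move=> x; apply: (@cvg_comp _ _ _ (fun x => c + r * x) clamp);
  last exact: continuous_clamp.
by apply: cvgD; [exact: cvg_cst|exact: mulrl_continuous].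
Qed.

Lemma clamp_lipschitz x y : `|clamp x - clamp y| <= `|x - y|.
Proof.
wlog xy : x y / x <= y.
  by move=> H; have [/H//|/ltW/H] := leP x y; rewrite distrC (distrC y).
rewrite distrC (distrC x) !ger0_norm ?subr_ge0 ?clamp_nd//.
rewrite /clamp !minEle !maxEle; case: (leP 0 x) => x0; case: (leP 0 y) => y0;
  try lra.
- by case: (leP 1 x) => x1; case: (leP 1 y) => y1; lra.
- by rewrite ler10; case: (leP 1 y) => y1; lra.
Qed.

Lemma bounded_clamp_affine c r :
  bounded_fun (fun x : R => clamp (c + r * x) : R).
Proof.
apply: (bounded_fun_boundP (fun x : R => clamp (c + r * x))).2.
by exists 1 => x; rewrite ger0_norm ?clamp_ge0 ?clamp_le1.
Qed.

End clamp.

Section tightness.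
Context {R : realType}.
Variables (N : nat -> nat) (B : nat -> {fset int}).
Hypothesis N_ge2 : forall k, (2 <= N k)%N.
Hypothesis B_gt0 : forall k, (0 < #|` B k|)%N.
Hypothesis B_ge0 : forall k b, b \in B k -> 0 <= b.

Let N_gt0 k : (0 < N k)%N. Proof. exact: ltnW. Qed.

Lemma size_digits_gt0 n w k : (0 < size (digits N B n w k : seq R))%N.
Proof. by rewrite size_map. Qed.

Lemma digits_ge0 n w k : {in (digits N B n w k : seq R), forall d, 0 <= d}.
Proof.
move=> _ /mapP[b bB ->]; rewrite mulr_ge0 ?ler0z ?(B_ge0 bB)//.
by rewrite ltW// weight_gt0.
Qed.

Hypothesis mu_exists :
  forall w : Omega R, infinite_conv_exists N B (fun=> 1%N) w.
Hypothesis Phi_tight :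
  tight [set infinite_conv N B (fun=> 1%N) w | w in [set: Omega R]].

(** Tightness bounds the tails of the limits mu(w) uniformly in w; the average
    of a nondecreasing function of the partial sums increases with the level,
    so the same bound holds for all finite levels. *)
Lemma uniform_tail_bound e : 0 < e -> exists2 r : R, 0 < r & forall w m,
  mean (digit_sums (digits N B (fun=> 1%N) w) m) (fun x => clamp (r * x)) <= e.
Proof.
move=> e0; have e20 : 0 < e / 2 by rewrite divr_gt0.
have [K cK Kinf] := Phi_tight e20.
have mK : measurable K.
  by apply: closed_measurable; apply: compact_closed => //; exact: Rhausdorff.
have [C C0 KC] : exists2 C, 0 < C & forall x, K x -> `|x| <= C.
  have [M [_ MP]] := compact_bounded cK.
  exists (`|M| + 1); first by rewrite ltr_pwDr.
  by move=> x Kx; apply: (MP _ _ x Kx); rewrite ltr_pwDr// ler_norm.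
have r0 : 0 < e / 2 / C by rewrite divr_gt0.
(* With this slope the test function is at most e / 2 on K, and it is at most
   1 on the complement of K, which has mass at most e / 2. *)
exists (e / 2 / C) => // w m; set r := e / 2 / C in r0 *.
pose g (x : R) := clamp (r * x).
have gnd : {homo g : x y / x <= y}.
  by move=> x y xy; apply: clamp_nd; rewrite ler_wpM2l// ltW.
have gE : g = (fun x => clamp (0 + r * x)).
  by apply/funext => x; rewrite add0r.
have cg : continuous g by rewrite gE; exact: continuous_clamp_affine.
have bg : bounded_fun g by rewrite gE; exact: bounded_clamp_affine.
pose nu := infinite_conv N B (fun=> 1%N) (w : Omega R).
have nu_lim : infinite_conv_limits N B (fun=> 1%N) (w : Omega R) nu.
  by apply: xgetPex; exact: mu_exists.
have ge_digit_sums k := @le_mean_digit_sumsS R _ k g gnd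
  (size_digits_gt0 (fun=> 1%N) w) (@digits_ge0 (fun=> 1%N) w).
apply: (le_trans (ge_digit_sums m)).
have /(_ g cg bg) := nu_lim.
have -> : (fun k => \int[finite_conv N B (fun=> 1%N) (w : Omega R) k]_x g x) =
    (fun k => mean (digit_sums (digits N B (fun=> 1%N) w) k.+1) g).
  apply/funext => k; rewrite Rintegral_finite_conv//.
  exact: continuous_measurable_fun.
move=> gnu; apply: (@le_trans _ _ (\int[nu]_x g x)).
  rewrite -(cvg_lim _ gnu)//.
  apply: (nondecreasing_cvgn_le _ (cvgP _ gnu)).
  by apply/nondecreasing_seqP => k; exact: ge_digit_sums.
have nuK : fine (nu (~` K)) <= e / 2.
  rewrite probability_setC// -lee_fin fineK ?fin_numB ?fin_num_measure//.
  rewrite leeBlDr ?fin_num_measure// addeC -leeBlDr//.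
  apply: le_trans (ltW Kinf) _; apply: ereal_inf_lbound; exists nu => //.
have mKC : measurable (~` K) by exact: measurableC.
apply: (@le_trans _ _ (\int[nu]_x (e / 2 + \1_(~` K) x))).
  apply: le_Rint; first exact: bmeasurable_continuous.
    by apply: bmeasurableD; [exact: bmeasurable_cst|exact: bmeasurable_indic].
  move=> x; rewrite indicE; have [Kx|Kx] := boolP (x \in ~` K).
    by rewrite (le_trans (clamp_le1 _))// lerDr ltW.
  rewrite addr0; have {}Kx : K x by rewrite notin_setE /= in Kx;
    exact: contrapT.
  rewrite (le_trans (clamp_nd (_ : _ <= e / 2)))//.
    rewrite /r mulrAC ler_pdivrMr// ler_pM2l// (le_trans (ler_norm _))//.
    exact: KC.
  by apply: clamp_le; exact: ltW.
rewrite RintD//; [|exact: bmeasurable_cst|exact: bmeasurable_indic].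
by rewrite Rint_cst Rint_indic// [leRHS](splitr e) lerD2l.
Qed.

(** Every base is at least 2, so each unit added to the first exponent at
    least halves every weight; raising the other exponents only makes the
    weights smaller. *)
Lemma weight_le n w k : (forall i, (0 < n i)%N) ->
  weight N n w k <= 2 ^- (n 0).-1 * weight N (fun=> 1%N) w k :> R.
Proof.
move=> n0; rewrite /weight !big_ord_recl mulrA ler_pM//.
- by apply: prodr_ge0 => i _; rewrite invr_ge0 exprn_ge0.
- rewrite -invfM lef_pV2 ?posrE ?mulr_gt0 ?exprn_gt0 ?ltr0n//.
  have -> : n (@ord0 k) = (n 0).-1.+1 by rewrite prednK.
  rewrite expr1 exprSr ler_pM2r ?ltr0n//.
  by rewrite lerXn2r ?nnegrE ?ler0n// ler_nat.
- apply: ler_prod => i _; rewrite invr_ge0 exprn_ge0//=.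
  rewrite lef_pV2 ?posrE ?exprn_gt0 ?ltr0n// ler_weXn2l// ler1n.
  exact: N_gt0.
Qed.

(** The comparison with exponents 1 that transports all tail bounds: the sums
    for exponents n are at most 2 ^- (n 0).-1 times those for exponents 1. *)
Lemma mean_clamp_exponents_le n w m (r : R) : (forall i, (0 < n i)%N) ->
  0 <= r ->
  mean (digit_sums (digits N B n w) m) (fun x => clamp (r * x)) <=
  mean (digit_sums (digits N B (fun=> 1%N) w) m)
    (fun x => clamp (r * (2 ^- (n 0).-1 * x))) :> R.
Proof.
move=> n0 r0.
have -> : mean (digit_sums (digits N B (fun=> 1%N) w) m)
    (fun x => clamp (r * (2 ^- (n 0).-1 * x))) =
  mean (digit_sums
    (fun i => [seq 2 ^- (n 0).-1 * d | d <- digits N B (fun=> 1%N) w i]) m)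
    (fun x => clamp (r * x)) by rewrite digit_sums_scale mean_map.
apply: (@le_mean_digit_sums_weights _ _ _ _ (fun i => B (w i))
  (fun i b => weight N n w i * b%:~R)
  (fun i b => 2 ^- (n 0).-1 * (weight N (fun=> 1%N) w i * b%:~R))) => //.
- by move=> x y xy; apply: clamp_nd; rewrite ler_wpM2l.
- move=> i b bB; rewrite mulrA ler_wpM2r ?ler0z ?(B_ge0 bB)//.
  exact: weight_le.
- by move=> i; rewrite -map_comp.
Qed.

(** No mass escapes to infinity, whatever the positive exponents: the sums are
    dominated by those for exponents 1. *)
Lemma digits_tail n w : (forall i, (0 < n i)%N) ->
  forall e : R, 0 < e -> exists C, forall m,
  1 - mean_cdf (digit_sums (digits N B n w) m) C <= e.
Proof.
move=> n0 e /uniform_tail_bound[r r0 rP]; exists r^-1 => m.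
have s0 : (0 < size (digit_sums (digits N B n w : nat -> seq R) m))%N.
  by apply: size_digit_sums_gt0; exact: size_digits_gt0.
rewrite -[X in X - _](mean_cst _ s0) /mean_cdf -meanB; apply: le_trans (rP w m).
apply: le_trans (le_trans (mean_clamp_exponents_le w m n0 (ltW r0)) _);
  last first.
  apply: le_mean => x xs; apply: clamp_nd; rewrite ler_pM2l//.
  rewrite ler_piMl//.
    exact: (digit_sums_ge0 (@digits_ge0 _ _)) xs.
  by rewrite invf_le1 ?exprn_gt0// exprn_ege1// ler1n.
apply: le_mean => x _; case: (leP x r^-1) => xr;
  first by rewrite subrr clamp_ge0.
by rewrite subr0 clamp_eq1// mulrC -ler_pdivrMr// div1r ltW.
Qed.

(** A large first exponent shrinks the sums by so much that tightness turns
    into convergence to 0, uniformly in the word, the other exponents and the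
    number of digits. An unbounded sequence of exponents has shifts to which
    this applies, with any prescribed accuracy. *)
Lemma rescaled_tails_near0 e : 0 < e -> exists q, forall n w m,
  (forall i, (0 < n i)%N) ->
  (q < n 0)%N -> mean (digit_sums (digits N B n w) m) (fun x : R => clamp x) <=
    e.
Proof.
move=> /uniform_tail_bound[r r0 rP].
exists (Num.truncn r^-1).+1 => n w m n0 qn; apply: le_trans (rP w m).
rewrite (eq_mean (h := fun x => clamp (1 * x))); last by move=> x _;
  rewrite mul1r.
apply: (le_trans (mean_clamp_exponents_le w m n0 ler01)).
apply: le_mean => x xs; apply: clamp_nd; rewrite mul1r ler_wpM2r//.
  exact: (digit_sums_ge0 (@digits_ge0 _ _)) xs.
rewrite -[leRHS]invrK lef_pV2 ?posrE ?exprn_gt0 ?invr_gt0//.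
apply: (le_trans (ltW (truncnS_gt _))).
rewrite -natrX ler_nat; apply: (@leq_trans (n 0).-1); last exact/ltnW/ltn_expl.
by rewrite -ltnS prednK//.
Qed.

(** The digits after the first k ones are, up to a common factor, the digits
    of the shifted word with the shifted exponents. *)
Lemma digits_shift n w k i : digits N B n w (k + i) =
  [seq (\prod_(j < k) (N (w j))%:R ^- n j) * d |
     d <- digits N B (fun j => n (k + j)%N) (fun j => w (k + j)%N) i] :> seq R.
Proof.
rewrite /digits -map_comp; apply: eq_map => b /=; rewrite mulrA; congr (_ * _).
by rewrite /weight -addnS big_split_ord.
Qed.

End tightness.

(** * Complex exponentials and Hadamard sets of frequencies *)

Section cexp.
Context {R : realType}.
Implicit Types (s t : R) (z : R[i]).

Lemma cexpD s t : cexp (s + t) = cexp s * cexp t.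
Proof.
apply/eqP; rewrite eq_complex /= !mulrDr cosD sinD eqxx /=.
by apply/eqP; ring.
Qed.

Lemma cexp0 : cexp (0 : R) = 1.
Proof. by rewrite /cexp mulr0 cos0 sin0. Qed.

Lemma cexp1 : cexp (1 : R) = 1.
Proof. by rewrite /cexp mulr1 mulr_natl cos2pi sin2pi. Qed.

Lemma cexpN t : cexp (- t) = (cexp t)^*.
Proof. by rewrite /cexp mulrN cosN sinN. Qed.

Lemma cexp_int (a : int) : cexp (a%:~R : R) = 1.
Proof.
have nat_case k : cexp (k%:R : R) = 1.
  by elim: k => [|k IH]; rewrite ?cexp0// -natr1 cexpD IH cexp1 mulr1.
case: a => k; first exact: nat_case.
by rewrite NegzE mulrNz cexpN nat_case conjC1.
Qed.

(** The squared modulus, kept in R rather than in R[i] so that it can be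
    integrated. *)
Definition sqmod z : R := complex.Re z ^+ 2 + complex.Im z ^+ 2.

Lemma sqmodE z : (sqmod z)%:C%C = z * z^*.
Proof.
case: z => a b; apply/eqP; rewrite eq_complex /= /sqmod /=.
by apply/andP; split; apply/eqP; ring.
Qed.

Lemma sqmod_ge0 z : 0 <= sqmod z.
Proof. by rewrite addr_ge0 ?sqr_ge0. Qed.

Lemma sqmodM z1 z2 : sqmod (z1 * z2) = sqmod z1 * sqmod z2.
Proof. by case: z1 z2 => [a b] [c d]; rewrite /sqmod /=; ring. Qed.

Lemma sqmod_cexp t : sqmod (cexp t) = 1.
Proof. by rewrite /sqmod /= cos2Dsin2. Qed.

Lemma sqmodD_le z1 z2 : sqmod (z1 + z2) <= 2 * sqmod z1 + 2 * sqmod z2.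
Proof.
case: z1 z2 => [a b] [c d]; rewrite /sqmod /=.
have := sqr_ge0 (a - c); have := sqr_ge0 (b - d); lra.
Qed.

Lemma normc_sqr z : Normc.normc z ^+ 2 = sqmod z.
Proof.
by case: z => a b; rewrite /Normc.normc sqr_sqrtr// addr_ge0 ?sqr_ge0.
Qed.

End cexp.

Section Hadamard.
Context {R : realType}.

(** The matrix is square, so its columns are orthonormal as soon as its rows
    are. *)
Lemma unitary_col_orthogonal (C : numClosedFieldType) (s t : nat)
  (f : nat -> nat -> C) :
  t = s -> \matrix_(i < s, j < t) f i j \is unitarymx ->
  forall i j : nat, (i < t)%N -> (j < t)%N ->
  \sum_(k < s) f k i * (f k j)^* = (i == j)%:R.
Proof.
move=> -> + i j it jt; rewrite -trmx_unitary => /unitarymxP.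
move=> /matrixP/(_ (Ordinal it) (Ordinal jt)); rewrite !mxE => <-.
by apply: eq_bigr => k _; rewrite !mxE.
Qed.

(** Orthogonality of the columns, which are indexed by the frequencies; the
    sum over a column runs over the digits. *)
Lemma sum_cexp_admissible N (B : {fset int}) : @admissible_pair R N B ->
  exists L : seq int, [/\ uniq L, size L = #|` B| &
    forall l l', l \in L -> l' \in L -> l != l' ->
      \sum_(b <- B) cexp ((b * (l - l'))%:~R / N%:R : R) = 0].
Proof.
move=> [N2 B2 [L LB uB]].
have U := @unitary_col_orthogonal _ _ _ (fun i j : nat =>
  (Num.sqrt #|` B|%:R)^-1%:C%C * cexp (- (nth 0 B i * nth 0 L j)%:~R / N%:R :
    R))
  LB uB.
exists L; split => [|//|l l' lL l'L ll']; first exact: fset_uniq.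
pose i := index l L; pose j := index l' L.
have iL : (i < #|` L|)%N by rewrite index_mem.
have jL : (j < #|` L|)%N by rewrite index_mem.
have ij : i != j.
  by apply: contra ll' => /eqP ij; rewrite -(nth_index 0 lL) -/i ij nth_index.
have := U j i jL iL; rewrite eq_sym (negbTE ij) => Uij.
have c0 : ((Num.sqrt #|` B|%:R)^-1 : R) ^+ 2 != 0.
  by rewrite sqrf_eq0 invr_eq0 sqrtr_eq0 -ltNge ltr0n ltnW.
have c0' : (((Num.sqrt #|` B|%:R)^-1 : R) ^+ 2)%:C%C != 0.
  by apply: contra c0 => /eqP[->].
apply: (mulfI c0'); rewrite mulr0 -{}[RHS]Uij (big_nth 0) big_mkord mulr_sumr.
apply: eq_bigr => k _; rewrite !nth_index//.
have scaled (c s t : R) : (c ^+ 2)%:C%C * cexp (t - s) =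
    (c%:C%C * cexp (- s)) * (c%:C%C * cexp (- t))^*.
  have conjM (x y : R[i]) : (x * y)^* = x^* * y^* by exact: rmorphM.
  rewrite conjM -cexpN opprK cexpD expr2 [X in X * _ = _]rmorphM.
  have -> : (c%:C%C)^* = c%:C%C :> R[i].
    by apply/eqP; rewrite eq_complex /= oppr0 !eqxx.
  by rewrite [cexp t * _]mulrC mulrACA.
rewrite !mulNr -scaled; congr (_ * cexp _).
by rewrite -mulrBl -rmorphB -mulrBr.
Qed.

End Hadamard.

Lemma symmetric_residue (M : nat) (l : int) : (0 < M)%N ->
  exists2 r, (2 * `|r| <= M)%N & exists q, r = l + q * M%:Z.
Proof.
move=> M0; have Mne : M%:Z != 0 by rewrite eqz_nat -lt0n.
have e := divz_eq l M%:Z.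
have r0 := modz_ge0 l Mne; have rM : (l %% M%:Z)%Z < M%:Z by apply: ltz_pmod;
  rewrite ltz_nat.
have [h|h] := leP (2 * (l %% M%:Z)%Z) M%:Z.
  exists (l %% M%:Z)%Z; first by lia.
  by exists (- (l %/ M%:Z)%Z); lia.
exists ((l %% M%:Z)%Z - M%:Z); first by lia.
by exists (- (l %/ M%:Z)%Z - 1); lia.
Qed.

(** Multiplying the frequencies by N ^ (n - 1) turns a Hadamard set for N into
    one for N ^ n. Orthogonality depends only on differences of frequencies
    modulo N ^ n, so the set can be translated to contain 0 and reduced to the
    residues of least absolute value; the reduction is injective because
    distinct frequencies are orthogonal. *)
Lemma balanced_Hadamard_set (R : realType) N (B : {fset int}) n :
  @admissible_pair R N B -> (0 < n)%N ->
  exists L : seq int, [/\ uniq L, size L = #|` B|, 0 \in L,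
    {in L, forall l, (2 * `|l| <= N ^ n)%N} &
    {in L &, forall l l', l != l' ->
      \sum_(b <- B) cexp ((b * (l - l'))%:~R / (N ^ n)%:R : R) = 0}].
Proof.
move=> adm n0; have [L [uL sL oL]] := sum_cexp_admissible adm.
case: adm => N2 B2 _; have N0 : (0 < N)%N by exact: ltnW.
have M0 : (0 < N ^ n)%N by rewrite expn_gt0 N0.
have [l0 l0L] : exists l0, l0 \in L.
  by exists (nth 0 L 0); apply: mem_nth; rewrite sL ltnW.
have /choice[g0 g0P] : forall l, exists r, (2 * `|r| <= N ^ n)%N /\
    exists q, r = (N ^ n.-1)%:Z * (l - l0) + q * (N ^ n)%:Z.
  move=> l; have [r rM rq] :=
    @symmetric_residue (N ^ n) ((N ^ n.-1)%:Z * (l - l0)) M0.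
  by exists r.
have gM l : (2 * `|g0 l| <= N ^ n)%N by case: (g0P l).
have gq l : exists q, g0 l = (N ^ n.-1)%:Z * (l - l0) + q * (N ^ n)%:Z.
  by case: (g0P l).
(* The residue of 0 may be chosen to be 0. *)
pose g l := if l == l0 then 0 else g0 l.
have {}gM l : (2 * `|g l| <= N ^ n)%N by rewrite /g; case: eqP.
have {}gq l : exists q, g l = (N ^ n.-1)%:Z * (l - l0) + q * (N ^ n)%:Z.
  by rewrite /g; case: eqP => // ->; exists 0; rewrite subrr mulr0 mul0r addr0.
have cexp_g b l l' : cexp ((b * (g l - g l'))%:~R / (N ^ n)%:R : R) =
    cexp ((b * (l - l'))%:~R / N%:R : R).
  have [q ->] := gq l; have [q' ->] := gq l'.
  rewrite -[RHS]mulr1 -(cexp_int (b * (q - q'))) -cexpD; congr cexp.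
  have Ne : N%:R != 0 :> R by rewrite pnatr_eq0 -lt0n.
  have -> : (N ^ n)%:R = (N ^ n.-1)%:R * N%:R :> R.
    by rewrite -natrM -expnSr prednK.
  have -> : (N ^ n)%:Z = (N ^ n.-1)%:Z * N%:Z by rewrite -PoszM -expnSr prednK.
  have N1e : (N ^ n.-1)%:R != 0 :> R by rewrite pnatr_eq0 -lt0n expn_gt0 N0.
  rewrite !(rmorphM, rmorphD, rmorphB, rmorphN) /= -!pmulrn.
  by field; rewrite Ne N1e.
have og l l' : l \in L -> l' \in L -> l != l' ->
    \sum_(b <- B) cexp ((b * (g l - g l'))%:~R / (N ^ n)%:R : R) = 0.
  by move=> lL l'L ll'; under eq_bigr do rewrite cexp_g; exact: oL.
exists [seq g l | l <- L]; split.
- rewrite map_inj_in_uniq// => l l' lL l'L gll'; apply/eqP/negPn/negP => ll'.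
  have := og _ _ lL l'L ll'; rewrite gll' subrr.
  under eq_bigr do rewrite mulr0 mul0r cexp0.
  rewrite big_const_seq count_predT iter_addr_0 => /eqP.
  by rewrite pnatr_eq0 -leqn0 leqNgt (ltnW B2).
- by rewrite size_map.
- by apply/mapP; exists l0 => //; rewrite /g eqxx.
- by move=> _ /mapP[l _ ->].
move=> _ _ /mapP[l lL ->] /mapP[l' l'L ->] gll'; apply: og => //.
by apply: contra gll' => /eqP ->.
Qed.

(** * Frequencies of the finite levels *)

Section spectrum.
Context {R : realType}.
Variables (M : nat -> nat) (b L : nat -> seq int).
Hypothesis M_ge2 : forall k, (2 <= M k)%N.
Hypothesis b_gt0 : forall k, (0 < size (b k))%N.
Hypothesis sizeL : forall k, size (L k) = size (b k).
Hypothesis L0 : forall k, 0 \in L k.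
Hypothesis L_uniq : forall k, uniq (L k).
Hypothesis L_small : forall k, {in L k, forall l, (2 * `|l| <= M k)%N}.
Hypothesis L_orth : forall k, {in L k &, forall l l', l != l' ->
  \sum_(x <- b k) cexp ((x * (l - l'))%:~R / (M k)%:R : R) = 0}.

Definition scale k : nat := \prod_(j < k) M j.

Lemma scaleS k : scale k.+1 = (scale k * M k)%N.
Proof. by rewrite /scale big_ord_recr. Qed.

Lemma scale_gt0 k : (0 < scale k)%N.
Proof. by apply: prodn_gt0 => i; rewrite ltnW. Qed.

(** The atoms, with multiplicity, of the convolution of the first k factors,
    for bases M and digits b. *)
Definition points k : seq R :=
  digit_sums (fun i => [seq (scale i.+1)%:R^-1 * x%:~R | x <- b i]) k.

(** The frequencies that make the exponentials an orthonormal basis on the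
    level k; they are nested because 0 belongs to every L k. *)
Fixpoint spec k : seq int :=
  if k is k'.+1 then [seq (t + (scale k')%:Z * l) | t <- spec k', l <- L k']
  else [:: 0].

Lemma size_spec k : size (spec k) = size (points k).
Proof.
elim: k => // k IH; rewrite /points /= !size_allpairs size_map.
by rewrite sizeL IH.
Qed.

Lemma size_points_gt0 k : (0 < size (points k))%N.
Proof. by apply: size_digit_sums_gt0 => i; rewrite size_map. Qed.

(** By induction, since |t + P l| <= P + P m / 2 <= P m when |t| <= P, 2 |l|
    <= m and m >= 2. This is where the residues of least absolute value
    matter: rescaled frequencies stay in the unit interval. *)
Lemma spec_small k : {in spec k, forall t, (`|t| <= scale k)%N}.
Proof.
elim: k => [t|k IH _ /allpairsP[[t l] /= [tS lL ->]]].
  by rewrite inE => /eqP ->.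
have := IH t tS; have := L_small lL; have := M_ge2 k; rewrite scaleS.
move: (scale k) (M k) => P m m2 lm tP.
have h : (2 * `|(P%:Z * l)%R| <= P * m)%N by rewrite abszM; nia.
have h2 : (2 * P <= P * m)%N by nia.
lia.
Qed.

Lemma spec_sub k : {subset spec k <= spec k.+1}.
Proof.
move=> t tS; apply/allpairsP; exists (t, 0) => /=; split => //.
by rewrite mulr0 addr0.
Qed.

Lemma spec_le k k' : (k <= k')%N -> {subset spec k <= spec k'}.
Proof.
move=> /subnK <-; elim: (k' - k)%N => // i IH t tS.
by rewrite addSn; apply: spec_sub; exact: IH.
Qed.

(** The points of the level k have denominator scale k, so frequencies that
    are multiples of scale k are trivial on them. *)
Lemma points_integral k :
  {in points k, forall x, exists z : int, (scale k)%:R * x = z%:~R}.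
Proof.
elim: k => [x|k IH].
  by rewrite inE => /eqP ->; exists 0; rewrite mulr0.
move=> _ /allpairsP[[x d] /= [xS /mapP[y yb ->] ->]].
have [z zE] := IH _ xS; exists (z * (M k)%:Z + y).
rewrite mulrDr mulrA divff ?pnatr_eq0 -?lt0n ?scale_gt0// mul1r scaleS natrM.
by rewrite mulrAC zE intrD intrM.
Qed.

(** The new frequency l contributes an integer phase on the points of the
    level k, hence acts on the last digit only. *)
Lemma mean_points_split k (t l : int) :
  mean (points k.+1) (fun x => cexp ((t + (scale k)%:Z * l)%:~R * x)) =
  mean (points k) (fun x => cexp (t%:~R * x)) *
  mean (b k) (fun y => cexp (t%:~R * ((scale k.+1)%:R^-1 * y%:~R)) *
                       cexp ((y * l)%:~R / (M k)%:R)).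
Proof.
rewrite /points mean_digit_sumsS -/(points k) [RHS]mulrC -meanZ;
  apply: eq_mean => x xS.
rewrite mean_map [RHS]mulrC -meanZ; apply: eq_mean => y _ /=.
have [z zE] := points_integral xS.
have -> : (t + (scale k)%:Z * l)%:~R * (x + (scale k.+1)%:R^-1 * y%:~R) =
    t%:~R * x + (t%:~R * ((scale k.+1)%:R^-1 * y%:~R) + (y * l)%:~R / (M k)%:R)
      +
    (l * z)%:~R :> R.
  rewrite scaleS natrM !(intrD, intrM) -zE -!pmulrn.
  have P0 : (scale k)%:R != 0 :> R by rewrite pnatr_eq0 -lt0n scale_gt0.
  have M0 : (M k)%:R != 0 :> R by rewrite pnatr_eq0 -lt0n ltnW.
  by field; rewrite P0 M0.
by rewrite cexpD cexp_int mulr1 !cexpD.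
Qed.

(** Split the difference of two frequencies as t + P l. If t is nonzero the
    average over the first k digits vanishes by induction; if t = 0 and l is
    nonzero the average over the last digit vanishes. *)
Lemma spec_orthogonal k : uniq (spec k) /\
  {in spec k &, forall t t', t != t' ->
    mean (points k) (fun x => cexp ((t - t')%:~R * x)) = 0}.
Proof.
elim: k => [|k [uk ok]].
  by split=> // t t'; rewrite !inE => /eqP -> /eqP ->; rewrite eqxx.
have orth t l t' l' : t \in spec k -> l \in L k -> t' \in spec k ->
  l' \in L k ->
    (t, l) != (t', l') ->
    mean (points k.+1) (fun x => cexp (((t + (scale k)%:Z * l) -
      (t' + (scale k)%:Z * l'))%:~R * x)) = 0.
  move=> tS lL t'S l'L; have -> : (t + (scale k)%:Z * l) - (t' + (scale k)%:Z * l')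
      = (t - t') + (scale k)%:Z * (l - l') by ring.
  rewrite mean_points_split xpair_eqE negb_and.
  have [->|tt' _] := eqVneq t t'; last by rewrite ok// mul0r.
  move=> /= ll'; rewrite [X in _ * X](_ : _ = 0) ?mulr0// /mean.
  under eq_bigr do rewrite subrr mul0r cexp0 mul1r.
  by rewrite L_orth// mulr0.
(* Two pairs with the same sum would have the average of the constant 1 equal
   to 0. *)
have inj : {in [pred p | (p.1 \in spec k) && (p.2 \in L k)] &,
    injective (fun p : int * int => p.1 + (scale k)%:Z * p.2)}.
  move=> [t l] [t' l'] /= /andP[/= tS lL] /andP[/= t'S l'L] e.
  apply/eqP/negPn/negP => /(orth _ _ _ _ tS lL t'S l'L); rewrite e subrr.
  under eq_mean do rewrite mul0r cexp0.
  by rewrite mean_cst ?size_points_gt0// => /eqP; rewrite oner_eq0.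
split.
  apply: allpairs_uniq => //= p q.
  move=> /allpairsP[[t l] /= [tS lL ->]] /allpairsP[[t' l'] /= [t'S l'L ->]] e.
  by apply: inj => //=; rewrite ?inE /= ?tS ?lL ?t'S ?l'L.
move=> _ _ /allpairsP[[t l] /= [tS lL ->]] /allpairsP[[t' l'] /= [t'S l'L ->]]
  ne.
apply: orth => //; apply: contra ne => /eqP[-> ->] //.
Qed.

End spectrum.

(** * Mean square error of finite Fourier sums *)

Section finite_orthonormal_system.
Context {C : numClosedFieldType} {T1 T2 : eqType}.
Variables (S : seq T1) (X : seq T2) (e : T1 -> T2 -> C).
Hypothesis S_uniq : uniq S.
Hypothesis sizeSX : size S = size X.
Hypothesis orthonormal : {in S &, forall t t',
  mean X (fun x => e t x * (e t' x)^*) = (t == t')%:R}.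

(** As many orthonormal functions as points form a basis: the matrix of values
    has a right inverse, which is also a left inverse because it is square. In
    particular the points of X are automatically distinct. *)
Lemma finite_expansion (f : T2 -> C) : {in X, forall x,
  f x = \sum_(t <- S) mean X (fun y => f y * (e t y)^*) * e t x}.
Proof.
case: S X S_uniq sizeSX orthonormal => [|t0 S'] [|x0 X'] // uS + + x1 x1X.
set S0 := t0 :: S' in uS *; set X0 := x0 :: X' in x1X *; move=> sSX on.
have sX : size S0 = size X0 := sSX.
pose n := size X0.
pose A : 'M[C]_n := \matrix_(i, j) e (nth t0 S0 i) (nth x0 X0 j).
pose B : 'M[C]_n :=
  \matrix_(j, i) ((n%:R)^-1 * (e (nth t0 S0 i) (nth x0 X0 j))^*).
have AB : A *m B = 1%:M.
  apply/matrixP => i j; rewrite !mxE.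
  have iS : (i < size S0)%N by rewrite sX.
  have jS : (j < size S0)%N by rewrite sX.
  have := on _ _ (mem_nth t0 iS) (mem_nth t0 jS).
  rewrite nth_uniq// => <-; rewrite /mean (big_nth x0) big_mkord mulr_sumr.
  by apply: eq_bigr => k _; rewrite !mxE mulrCA.
have BA := mulmx1C AB.
have jn : (index x1 X0 < n)%N by rewrite index_mem.
pose j1 := Ordinal jn.
transitivity (\sum_(j < n) f (nth x0 X0 j) * (B *m A) j j1).
  rewrite BA (bigD1 j1)//= big1 => [|j jj1].
    by rewrite mxE eqxx mulr1 addr0 /= nth_index.
  by rewrite mxE (negbTE jj1) mulr0.
under eq_bigr do rewrite mxE mulr_sumr.
rewrite exchange_big /= (big_nth t0) big_mkord sX; apply: eq_bigr => i _.
rewrite /mean (big_nth x0) big_mkord mulr_sumr mulr_suml.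
apply: eq_bigr => j _; rewrite !mxE /= nth_index//; ring.
Qed.

Lemma finite_parseval (c : T1 -> C) :
  mean X (fun x =>
    (\sum_(t <- S) c t * e t x) * (\sum_(t <- S) c t * e t x)^*) =
  \sum_(t <- S) c t * (c t)^*.
Proof.
rewrite (eq_mean (h := fun x =>
    \sum_(t <- S) \sum_(t' <- S) (c t * e t x) * (c t' * e t' x)^*));
      last first.
  by move=> x _; rewrite rmorph_sum big_distrlr.
rewrite mean_sum big_seq [RHS]big_seq; apply: eq_bigr => t tS.
rewrite mean_sum (bigD1_seq t)//= big_seq_cond big1 ?addr0 =>
  [|t' /andP[t'S t't]].
  under eq_mean do rewrite rmorphM mulrACA.
  by rewrite meanZ orthonormal// eqxx mulr1.
under eq_mean do rewrite rmorphM mulrACA.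
by rewrite meanZ orthonormal// eq_sym (negbTE t't) mulr0.
Qed.

End finite_orthonormal_system.

Lemma mean_exchange (K : numFieldType) (T1 T2 : eqType) (s : seq T1)
  (t : seq T2)
    (g : T1 -> T2 -> K) :
  mean s (fun x => mean t (g x)) = mean t (fun y => mean s (g ^~ y)).
Proof.
rewrite /mean -!mulr_sumr mulrCA; congr (_ * (_ * _)).
exact: exchange_big.
Qed.

Section one_minus_cexp.
Context {R : realType}.

Lemma one_minus_cos_le (v : R) : 1 - cos v <= `|v|.
Proof.
wlog v0 : v / 0 <= v.
  move=> H; have /orP[/H//|v0] := le_total 0 v.
  by rewrite -cosN -normrN; apply: H; rewrite oppr_ge0.
have [|c _ cP] := @MVT_segment R cos (fun x => - sin x) 0 v v0.
  by apply/continuous_subspaceT => x; exact: continuous_cos.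
move: cP; rewrite cos0 subr0 => /eqP; rewrite subr_eq => /eqP ->.
rewrite ger0_norm// mulNr opprD opprK addrCA subrr addr0.
by rewrite ler_piMl// sin_le1.
Qed.

(** |1 - exp (2 pi i u)|^2 = 2 - 2 cos (2 pi u) is at most 4 and at most 4 pi
    |u|, and pi < 4. *)
Lemma sqmod_one_minus_cexp (u z : R) : `|u| <= z ->
  sqmod (1 - cexp u) <= 16 * clamp z.
Proof.
move=> uz; have -> : sqmod (1 - cexp u) = 2 - 2 * cos (2 * pi * u).
  rewrite /sqmod /cexp /= sub0r sqrrN sqrrB expr1n mul1r.
  by have := cos2Dsin2 (2 * pi * u); lra.
apply: (@le_trans _ _ (16 * clamp `|u|)); last by rewrite ler_pM2l// clamp_nd.
have [u1|u1] := leP 1 `|u|.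
  by rewrite clamp_eq1// mulr1; have := cos_geN1 (2 * pi * u); lra.
rewrite /clamp max_r// (min_r (ltW u1)).
have := one_minus_cos_le (2 * pi * u).
have -> : `|2 * pi * u| = 2 * (pi * `|u|).
  by rewrite mulrA normrM ger0_norm// mulr_ge0 ?pi_ge0.
have p4 : pi * `|u| <= 4 * `|u|.
  by rewrite ler_wpM2r//; have := @pihalf_lt2 R; lra.
have := normr_ge0 u; lra.
Qed.

End one_minus_cexp.

Section core_estimate.
Context {R : realType}.
Variables (M : nat -> nat) (b L : nat -> seq int).
Hypothesis M_ge2 : forall k, (2 <= M k)%N.
Hypothesis b_gt0 : forall k, (0 < size (b k))%N.
Hypothesis sizeL : forall k, size (L k) = size (b k).
Hypothesis L_uniq : forall k, uniq (L k).
Hypothesis L_small : forall k, {in L k, forall l, (2 * `|l| <= M k)%N}.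
Hypothesis L_orth : forall k, {in L k &, forall l l', l != l' ->
  \sum_(x <- b k) cexp ((x * (l - l'))%:~R / (M k)%:R : R) = 0}.

Let X := @points R M b.
Let S := spec M L.

Definition fourier_coef k (f : R -> R) (t : int) : R[i] :=
  mean (X k) (fun x => (f x)%:C%C * (cexp (t%:~R * x))^*).

(** An interpolation of f: the two agree on the points of the level k, while
    the sum makes sense on the whole line. *)
Definition fourier_sum k f (x : R) : R[i] :=
  \sum_(t <- S k) fourier_coef k f t * cexp (t%:~R * x).

Lemma spec_orthonormal k : {in S k &, forall t t' : int,
  mean (X k) (fun x => cexp (t%:~R * x) * (cexp (t'%:~R * x))^*) = (t ==
    t')%:R}.
Proof.
move=> t t' tS t'S; have [_ ok] := spec_orthogonal M_ge2 b_gt0 L_uniq L_orth k.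
rewrite (eq_mean (h := fun x => cexp ((t - t')%:~R * x))); last first.
  by move=> x _; rewrite -cexpN -cexpD rmorphB mulrBl.
have [->|tt'] := eqVneq t t'; last by rewrite ok.
under eq_mean do rewrite subrr mul0r cexp0.
by rewrite mean_cst//; exact: size_points_gt0.
Qed.

Lemma fourier_sum_points k f :
  {in X k, forall x, (f x)%:C%C = fourier_sum k f x}.
Proof.
have [uk _] := spec_orthogonal M_ge2 b_gt0 L_uniq L_orth k.
exact: (@finite_expansion _ _ _ (S k) (X k)
  (fun t x => cexp (t%:~R * x)) uk (size_spec _ sizeL k) (@spec_orthonormal k)
  (fun x => (f x)%:C%C)).
Qed.

Lemma mean_sqmod_spec k (c : int -> R[i]) :
  mean (X k) (fun x => sqmod (\sum_(t <- S k) c t * cexp (t%:~R * x))) =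
  \sum_(t <- S k) sqmod (c t).
Proof.
have [uk _] := spec_orthogonal M_ge2 b_gt0 L_uniq L_orth k.
apply: complexI; rewrite mean_rmorph rmorph_sum /=.
under [RHS]eq_bigr do rewrite sqmodE.
rewrite -(finite_parseval uk (@spec_orthonormal k)).
by apply: eq_mean => x _ /=; rewrite sqmodE.
Qed.

(** A point of the level k + m is x + y with x a point of the level k and y a
    rescaled tail z / scale k. Since f x is the Fourier sum of f at x, the
    error at x + y is f (x + y) - f x plus the sum of the c_t (1 - exp (2 pi i
    t y)) exp (2 pi i t x). Both parts are controlled by clamp z: the first by
    the modulus of continuity of f, the second, after Parseval in x, because
    |t| <= scale k. The bound does not depend on m, so it survives in the
    limit. *)
Lemma fourier_sum_error k m (f : R -> R) (E : nat -> seq R) K d :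
  (forall x, `|f x| <= 1) ->
  (forall x y, 0 <= y -> (f (x + y) - f x) ^+ 2 <= K * clamp y) -> 0 <= K ->
  (forall i, {in E i, forall z, 0 <= z}) -> (forall i, (0 < size (E i))%N) ->
  (forall i, [seq (scale M (k + i).+1)%:R^-1 * x%:~R | x <- b (k + i)] =
     [seq (scale M k)%:R^-1 * z | z <- E i]) ->
  mean (digit_sums E m) clamp <= d ->
  mean (X (k + m)) (fun x => sqmod ((f x)%:C%C - fourier_sum k f x)) <=
    (2 * K + 32) * d.
Proof.
move=> f1 fK K0 E0 Es bE Ed; rewrite /X /points mean_digit_sumsD.
have -> : (fun i =>
  [seq (scale M (k + i).+1)%:R^-1 * x%:~R | x <- b (k + i)%N]) =
    (fun i => [seq (scale M k)%:R^-1 * z | z <- E i]) :> (nat -> seq R).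
  by apply/funext => i; rewrite bE.
rewrite digit_sums_scale -/(points M b k) -/(X k).
set P : R := (scale M k)%:R.
have sX : (0 < size (X k))%N by exact: size_points_gt0.
have P1 : 1 <= P by rewrite ler1n scale_gt0.
have P0 : 0 < P by rewrite (lt_le_trans _ P1).
have zE0 z : z \in digit_sums E m -> 0 <= z by exact: digit_sums_ge0.
(* A bounds the contribution of the variation of f, B that of the
   exponentials. *)
pose A x z := 2 * (f (x + P^-1 * z) - f x) ^+ 2.
pose c t : R[i] := fourier_coef k f t.
pose B x z := 2 * sqmod (\sum_(t <- S k)
  (c t * (1 - cexp (t%:~R * (P^-1 * z)))) * cexp (t%:~R * x)).
have pw : {in X k, forall x, {in digit_sums E m, forall z,
   sqmod ((f (x + P^-1 * z))%:C%C - fourier_sum k f (x + P^-1 * z)) <=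
     A x z + B x z}}.
  move=> x xS z zS; rewrite /A /B.
  have -> : (f (x + P^-1 * z) - f x) ^+ 2 = sqmod (f (x + P^-1 * z) - f x)%:C%C.
    by rewrite /sqmod /= expr0n addr0.
  apply: le_trans (sqmodD_le _ _).
  rewrite le_eqVlt; apply/orP; left; apply/eqP; congr sqmod.
  rewrite rmorphB /= -[RHS]addrA; congr (_ + _).
  rewrite (fourier_sum_points f xS) /fourier_sum -!sumrN -big_split /=.
  by apply: eq_bigr => t _; rewrite mulrDr cexpD -/(c t); ring.
have zu z t : z \in digit_sums E m -> t \in S k -> `|t%:~R * (P^-1 * z)| <= z.
  move=> /zE0 z0 tS; rewrite !normrM normfV (ger0_norm z0) (ger0_norm (ltW P0)).
  rewrite mulrA -[leRHS]mul1r ler_wpM2r// ler_pdivrMr// mul1r.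
  have -> : `|t%:~R : R| = (`|t|%N)%:R by rewrite -intr_norm -abszE.
  by rewrite ler_nat (spec_small M_ge2 L_small tS).
apply: (@le_trans _ _
  (mean (X k) (fun x => mean (digit_sums E m) (fun z => A x z + B x z)))).
  apply: le_mean => x xS; rewrite mean_map; apply: le_mean => z zS.
  exact: pw.
apply: (@le_trans _ _ (mean (X k) (fun x => mean (digit_sums E m) (A x)) +
                       mean (digit_sums E m) (fun z => mean (X k) (B^~ z)))).
  rewrite -(mean_exchange (X k) (digit_sums E m) B) -meanD;
    apply: le_mean => x _; rewrite meanD.
  exact: lexx.
rewrite mulrDl lerD//.
  rewrite -[leRHS](mean_cst _ sX).
  apply: le_mean => x _; rewrite /A meanZ -mulrA ler_pM2l//.
  apply: (@le_trans _ _ (K * mean (digit_sums E m) clamp));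
    last by rewrite ler_wpM2l.
  rewrite -meanZ; apply: le_mean => z /zE0 z0.
  apply: le_trans (fK _ _ _) _; first by rewrite mulr_ge0// invr_ge0 ltW.
  rewrite ler_wpM2l// clamp_nd// ler_piMl// invf_le1//.
(* Parseval on the level k, where the Fourier sum is f itself. *)
have c1 : \sum_(t <- S k) sqmod (c t) <= 1.
  rewrite -mean_sqmod_spec -[leRHS](mean_cst _ sX).
  apply: le_mean => x xS; rewrite -/(fourier_sum k f x) -fourier_sum_points//.
  by rewrite /sqmod /= expr0n addr0 -real_normK ?num_real// exprn_ile1.
apply: (@le_trans _ _ (32 * mean (digit_sums E m) clamp));
  last by rewrite ler_wpM2l.
rewrite -meanZ; apply: le_mean => z zS; rewrite /B meanZ mean_sqmod_spec.
rewrite (_ : 32 = 2 * 16 :> R); last by ring.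
rewrite -[leRHS]mulrA ler_pM2l//.
apply: (@le_trans _ _ ((\sum_(t <- S k) sqmod (c t)) * (16 * clamp z))).
  rewrite mulr_suml !big_seq; apply: ler_sum => t tS.
  rewrite sqmodM ler_wpM2l ?sqmod_ge0//; apply: sqmod_one_minus_cexp; exact: zu.
by rewrite -[leRHS]mul1r ler_wpM2r// mulr_ge0// clamp_ge0.
Qed.

End core_estimate.

(** * From ramps to square-integrable functions *)

Section borel_induction.
Context {R : realType}.

(** The pi-lambda theorem for the half-lines, which generate the Borel sets.
    *)
Lemma borel_induction (H : set (set R)) : lambda_system setT H ->
  (forall x : R, H `]x, +oo[%classic) -> forall A, measurable A -> H A.
Proof.
move=> lH Hray A.
rewrite (_ : measurable A = (<<s @RGenOInfty.G R >>) A); last first.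
  by rewrite -[LHS]/(_ (ocitv (R:=R)).-sigma.-measurable A)
    RGenOInfty.measurableE.
move: A; apply: lambda_system_subset => //.
  move=> _ _ [x ->] [y ->]; exists (Num.max x y).
  apply/predeqP => z; rewrite /= !in_itv /= !andbT gt_max.
  by split=> [[-> ->]|/andP[]].
by move=> _ [x ->].
Qed.

(** Steeper and steeper ramps converge to the indicator of an open half-line.
    *)
Lemma ramp_cvg (x y : R) :
  (fun j => clamp (- (j%:R * x) + j%:R * y)) @ \oo -->
    (\1_(`]x, +oo[%classic) y : R).
Proof.
rewrite indicE mem_setE in_itv /= andbT; apply: cvg_near_cst.
have E j : - (j%:R * x) + j%:R * y = j%:R * (y - x) by rewrite mulrBr addrC.
have [yx|xy] := leP y x.
  near=> j; rewrite E /clamp max_l ?min_r//.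
  by rewrite mulr_ge0_le0// subr_le0.
near=> j; rewrite E clamp_eq1// -ler_pdivrMr ?subr_gt0// div1r.
near: j; exact: nbhs_infty_ger.
Unshelve. all: by end_near. Qed.

End borel_induction.

Section L2_closure.
Context {R : realType}.
Variable nu : probability R R.
Implicit Types f g p : R -> R[i].

Definition cmeasurable f :=
  measurable_fun [set: R] (fun x : R => complex.Re (f x) : R) /\
  measurable_fun [set: R] (fun x : R => complex.Im (f x) : R).

Definition L2sq f : \bar R := (\int[nu]_x (sqmod (f x))%:E)%E.

(** The squared norm without square roots. *)
Lemma sqnormL2E f : sqnormL2 nu f = L2sq f.
Proof. by apply: eq_integral => x _; rewrite normc_sqr. Qed.

Lemma cmeasurable_real (f : R -> R) : measurable_fun setT f ->
  cmeasurable (fun x => (f x)%:C%C).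
Proof. by move=> mf; split. Qed.

Lemma cmeasurable_cst (c : R[i]) : cmeasurable (fun=> c).
Proof. by split; exact: measurable_cst. Qed.

Lemma cmeasurableD f g : cmeasurable f -> cmeasurable g ->
  cmeasurable (fun x => f x + g x).
Proof.
move=> [mf1 mf2] [mg1 mg2]; split.
  rewrite (_ : (fun x : R => _) =
    (fun x : R => complex.Re (f x) + complex.Re (g x))).
    exact: measurable_funD.
  by apply/funext => x; case: (f x) (g x) => [? ?] [? ?].
rewrite (_ : (fun x : R => _) =
  (fun x : R => complex.Im (f x) + complex.Im (g x))).
  exact: measurable_funD.
by apply/funext => x; case: (f x) (g x) => [? ?] [? ?].
Qed.

Lemma cmeasurableM f g : cmeasurable f -> cmeasurable g ->
  cmeasurable (fun x => f x * g x).
Proof.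
move=> [mf1 mf2] [mg1 mg2]; split.
  rewrite (_ : (fun x : R => _) =
    (fun x : R => complex.Re (f x) * complex.Re (g x)
    - complex.Im (f x) * complex.Im (g x))).
    by apply: measurable_funB; exact: measurable_funM.
  by apply/funext => x; case: (f x) (g x) => [? ?] [? ?].
rewrite (_ : (fun x : R => _) =
    (fun x : R => complex.Re (f x) * complex.Im (g x)
    + complex.Im (f x) * complex.Re (g x))).
  by apply: measurable_funD; exact: measurable_funM.
by apply/funext => x; case: (f x) (g x) => [? ?] [? ?].
Qed.

Lemma cmeasurableZ (c : R[i]) f : cmeasurable f ->
  cmeasurable (fun x => c * f x).
Proof. by apply: cmeasurableM; exact: cmeasurable_cst. Qed.

Lemma cmeasurableB f g : cmeasurable f -> cmeasurable g ->
  cmeasurable (fun x => f x - g x).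
Proof.
move=> mf mg; under eq_fun do rewrite -mulN1r.
by apply: cmeasurableD => //; exact: cmeasurableZ.
Qed.

Lemma cmeasurable_sum (I : Type) (r : seq I) (F : I -> R -> R[i]) :
  (forall i, cmeasurable (F i)) -> cmeasurable (fun x => \sum_(i <- r) F i x).
Proof.
move=> mF; elim: r => [|i r IH].
  by under eq_fun do rewrite big_nil; exact: cmeasurable_cst.
by under eq_fun do rewrite big_cons; exact: cmeasurableD.
Qed.

Lemma continuous_cos_mul (l : R) :
  continuous (fun x : R => cos (2 * pi * (l * x))).
Proof.
move=> x; apply: (@cvg_comp _ _ _ (fun x : R => 2 * pi * (l * x)) cos);
  last exact: continuous_cos.
by apply: cvgM; [exact: cvg_cst|exact: mulrl_continuous].
Qed.

Lemma continuous_sin_mul (l : R) :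
  continuous (fun x : R => sin (2 * pi * (l * x))).
Proof.
move=> x; apply: (@cvg_comp _ _ _ (fun x : R => 2 * pi * (l * x)) sin);
  last exact: continuous_sin.
by apply: cvgM; [exact: cvg_cst|exact: mulrl_continuous].
Qed.

Lemma cmeasurable_cexp l : cmeasurable (fun x : R => cexp (l * x)).
Proof.
split; apply: continuous_measurable_fun => /=.
  exact: continuous_cos_mul.
exact: continuous_sin_mul.
Qed.

Lemma measurable_sqmod f : cmeasurable f ->
  measurable_fun [set: R] (fun x => sqmod (f x)).
Proof.
by move=> [m1 m2]; apply: measurable_funD; exact: measurable_funX.
Qed.

Lemma measurable_sqmod_EFin f : cmeasurable f ->
  measurable_fun [set: R] (fun x => (sqmod (f x))%:E).
Proof. by move=> mf; apply/measurable_EFinP; exact: measurable_sqmod. Qed.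

Lemma sqmod_EFin_ge0 f (x : R) : [set: R] x ->
  (0 <= (sqmod (f x))%:E :> \bar R)%E.
Proof. by rewrite lee_fin sqmod_ge0. Qed.

Lemma L2sq_ge0 f : (0 <= L2sq f)%E.
Proof. by apply: integral_ge0 => x _; rewrite lee_fin sqmod_ge0. Qed.

Lemma L2sqZ c f : cmeasurable f ->
  (L2sq (fun x => c * f x)%R = (sqmod c)%:E * L2sq f)%E.
Proof.
move=> mf; rewrite /L2sq.
rewrite -(ge0_integralZl_EFin nu measurableT (@sqmod_EFin_ge0 f)
  (measurable_sqmod_EFin mf) (sqmod_ge0 c)).
by apply: eq_integral => x _; rewrite sqmodM EFinM.
Qed.

Lemma L2sqD_le f g : cmeasurable f -> cmeasurable g ->
  (L2sq (fun x => f x + g x)%R <= 2%:E * L2sq f + 2%:E * L2sq g)%E.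
Proof.
move=> mf mg.
have m2 h : cmeasurable h ->
  measurable_fun [set: R] (fun x => (2%:E * (sqmod (h x))%:E)%E).
  by move=> mh; apply: measurable_funeM; exact: measurable_sqmod_EFin.
have ge2 h (x : R) : [set: R] x -> (0 <= 2%:E * (sqmod (h x))%:E :> \bar R)%E.
  by move=> _; rewrite mule_ge0// lee_fin sqmod_ge0.
rewrite /L2sq -(ge0_integralZl_EFin nu measurableT (@sqmod_EFin_ge0 f)
  (measurable_sqmod_EFin mf) (ler0n R 2)).
rewrite -(ge0_integralZl_EFin nu measurableT (@sqmod_EFin_ge0 g)
  (measurable_sqmod_EFin mg) (ler0n R 2)).
rewrite -(ge0_integralD nu measurableT (ge2 f) (m2 _ mf) (ge2 g) (m2 _ mg)).
apply: ge0_le_integral => //.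
- by move=> x _; rewrite lee_fin sqmod_ge0.
- by apply: measurable_sqmod_EFin; exact: cmeasurableD.
- by apply: emeasurable_funD; exact: m2.
by move=> x _; rewrite -!EFinM -EFinD lee_fin sqmodD_le.
Qed.

Variable Lam : set R.

Definition trig_span p := exists (s : {fset R}) (c : R -> R[i]),
  [set` s] `<=` Lam /\ forall x, p x = \sum_(l <- s) c l * cexp (l * x).

Definition approximable f := forall eps : R, 0 < eps ->
  exists2 p, trig_span p & (L2sq (fun x => f x - p x)%R < eps%:E)%E.

Lemma trig_span_measurable p : trig_span p -> cmeasurable p.
Proof.
move=> [s [c [_ pE]]]; rewrite (funext pE); apply: cmeasurable_sum => l.
by apply: cmeasurableZ; exact: cmeasurable_cexp.
Qed.

Lemma trig_spanZ (a : R[i]) p : trig_span p -> trig_span (fun x => a * p x).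
Proof.
move=> [s [c [sL pE]]]; exists s, (fun l => a * c l); split=> // x.
by rewrite pE mulr_sumr; apply: eq_bigr => l _; rewrite mulrA.
Qed.

Lemma trig_spanD p q : trig_span p -> trig_span q ->
  trig_span (fun x => p x + q x).
Proof.
move=> [s [c [sL pE]]] [t [d [tL qE]]].
exists (s `|` t)%fset, (fun l => (if l \in s then c l else 0) +
                                 (if l \in t then d l else 0)); split.
  by move=> l /=; rewrite inE => /orP[/sL|/tL].
move=> x; rewrite pE qE; under [RHS]eq_bigr do rewrite mulrDl.
rewrite big_split /=; congr (_ + _).
  transitivity (\sum_(l <- s) (if l \in s then c l else 0) * cexp (l * x)).
    by apply: eq_big_seq => l ls; rewrite ls.
  apply: big_fset_incl => [|l ls /negbTE ls']; first exact: fsubsetUl.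
  by rewrite ls' mul0r.
transitivity (\sum_(l <- t) (if l \in t then d l else 0) * cexp (l * x)).
  by apply: eq_big_seq => l ls; rewrite ls.
apply: big_fset_incl => [|l ls /negbTE ls']; first exact: fsubsetUr.
by rewrite ls' mul0r.
Qed.

Lemma approximable_limit f : cmeasurable f ->
  (forall eps : R, 0 < eps -> exists2 g, cmeasurable g /\ approximable g &
     (L2sq (fun x => f x - g x)%R < eps%:E)%E) -> approximable f.
Proof.
move=> mf H eps eps0; have e4 : 0 < eps / 4 by rewrite divr_gt0.
have [g [mg ag] fg] := H _ e4; have [p sp gp] := ag _ e4; exists p => //.
have mp := trig_span_measurable sp.
rewrite (_ : (fun x => f x - p x) = (fun x => (f x - g x) + (g x - p x)));
  last first.
  by apply/funext => x; rewrite subrKA.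
apply: le_lt_trans (L2sqD_le (cmeasurableB mf mg) (cmeasurableB mg mp)) _.
rewrite (_ : eps%:E = 2%:E * (eps / 4)%:E + 2%:E * (eps / 4)%:E)%E; last first.
  by rewrite -!EFinM -EFinD; congr EFin; lra.
by rewrite lteD// lte_pmul2l.
Qed.

Lemma approximableD f g : cmeasurable f -> cmeasurable g ->
  approximable f -> approximable g -> approximable (fun x => f x + g x).
Proof.
move=> mf mg af ag eps eps0; have e4 : 0 < eps / 4 by rewrite divr_gt0.
have [p sp fp] := af _ e4; have [q sq gq] := ag _ e4.
exists (fun x => p x + q x); first exact: trig_spanD.
have mp := trig_span_measurable sp; have mq := trig_span_measurable sq.
rewrite (_ : (fun x => _ - _) = (fun x => (f x - p x) + (g x - q x)));
  last first.
  by apply/funext => x; ring.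
apply: le_lt_trans (L2sqD_le (cmeasurableB mf mp) (cmeasurableB mg mq)) _.
rewrite (_ : eps%:E = 2%:E * (eps / 4)%:E + 2%:E * (eps / 4)%:E)%E; last first.
  by rewrite -!EFinM -EFinD; congr EFin; lra.
by rewrite lteD// lte_pmul2l.
Qed.

Lemma approximableZ (a : R[i]) f : cmeasurable f -> approximable f ->
  approximable (fun x => a * f x).
Proof.
move=> mf af eps eps0; have a0 := sqmod_ge0 a.
have e0 : 0 < eps / (sqmod a + 1) by rewrite divr_gt0// ltr_wpDl.
have [p sp fp] := af _ e0; exists (fun x => a * p x); first exact: trig_spanZ.
rewrite (_ : (fun x => _ - _) = (fun x => a * (f x - p x))); last first.
  by apply/funext => x; rewrite mulrBr.
have mp := trig_span_measurable sp.
rewrite L2sqZ; last exact: cmeasurableB.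
apply: (@le_lt_trans _ _ ((sqmod a)%:E * (eps / (sqmod a + 1))%:E)%E).
  by rewrite lee_wpmul2l ?lee_fin// ltW.
rewrite -EFinM lte_fin mulrCA gtr_pMr// ltr_pdivrMr ?mul1r;
  last by rewrite ltr_wpDl.
by rewrite ltrDl.
Qed.

Lemma approximable_sum (I : Type) (r : seq I) (F : I -> R -> R[i]) :
  approximable (fun=> 0) ->
  (forall i, cmeasurable (F i)) -> (forall i, approximable (F i)) ->
  approximable (fun x => \sum_(i <- r) F i x).
Proof.
move=> a0 mF aF; elim: r => [|i r IH].
  by under eq_fun do rewrite big_nil.
under eq_fun do rewrite big_cons; apply: approximableD => //.
exact: cmeasurable_sum.
Qed.

(** Mean square convergence follows from dominated convergence of the squared
    distances. *)
Lemma approximable_dominated f (g : nat -> R -> R[i]) (G : R -> R) :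
  cmeasurable f -> (forall j, cmeasurable (g j)) ->
  (forall j, approximable (g j)) ->
  (forall x, (fun j => sqmod (f x - g j x)) @ \oo --> (0 : R)) ->
  nu.-integrable setT (EFin \o G) -> (forall j x, sqmod (f x - g j x) <= G x) ->
  approximable f.
Proof.
move=> mf mg ag fg iG gG; apply: approximable_limit => // eps eps0.
have m j : measurable_fun [set: R] (fun x => (sqmod (f x - g j x))%:E).
  by apply: measurable_sqmod_EFin; exact: cmeasurableB.
have c0 : {ae nu, forall x, [set: R] x ->
    (fun j => (sqmod (f x - g j x))%:E) @ \oo --> (0%E : \bar R)}.
  apply: aeW => x _; apply: cvg_EFin; first by near=> j.
  exact: fg.
have dom : {ae nu, forall x j, [set: R] x ->
  (`|(sqmod (f x - g j x))%:E| <= (EFin \o G) x)%E}.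
  by apply: aeW => x j _; rewrite gee0_abs ?lee_fin ?sqmod_ge0//; exact: gG.
have [_ _] := dominated_convergence measurableT m (measurable_cst _) c0 iG dom.
rewrite integral0 => /fine_cvgP[fin /cvgrPdist_lt/(_ _ eps0) small].
near \oo => j; exists (g j); first by split.
have fj : (L2sq (fun x => f x - g j x)%R \is a fin_num) by near: j; exact: fin.
rewrite -(fineK fj) lte_fin.
have : `|0 - fine (L2sq (fun x => f x - g j x)%R)| < eps by near: j;
  exact: small.
by rewrite sub0r normrN ger0_norm// fine_ge0// L2sq_ge0.
Unshelve. all: by end_near. Qed.

Hypothesis approximable_ramp : forall c r : R,
  approximable (fun x => (clamp (c + r * x))%:C%C).

Lemma approximable_cst (a : R[i]) : approximable (fun=> a).
Proof.
have m1 : cmeasurable (fun x : R => (clamp (1 + 0 * x))%:C%C).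
  apply: cmeasurable_real; under eq_fun do rewrite mul0r addr0.
  exact: measurable_cst.
have := approximableZ a m1 (approximable_ramp 1 0); congr approximable.
by apply/funext => x; rewrite mul0r addr0 clamp_eq1// mulr1.
Qed.

Lemma sqmod_real (a : R) : sqmod (a%:C%C) = a ^+ 2.
Proof. by rewrite /sqmod /= expr0n addr0. Qed.

Lemma approximable_dominated_real (f : R -> R) (g : nat -> R -> R)
  (G : R -> R) :
  measurable_fun setT f -> (forall j, measurable_fun setT (g j)) ->
  (forall j, approximable (fun x => (g j x)%:C%C)) ->
  (forall x, g ^~ x @ \oo --> f x) ->
  nu.-integrable setT (EFin \o G) -> (forall j x, (f x - g j x) ^+ 2 <= G x) ->
  approximable (fun x => (f x)%:C%C).
Proof.
move=> mf mg ag gf iG gG.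
apply: (@approximable_dominated _ (fun j x => (g j x)%:C%C) G) => //.
- by move=> j; exact: cmeasurable_real.
- move=> x.
  have -> : (fun j => sqmod ((f x)%:C%C - (g j x)%:C%C)) = (fun j =>
    (f x - g j x) ^+ 2).
    by apply/funext => j; rewrite -rmorphB sqmod_real.
  have -> : (0 : R) = (f x - f x) ^+ 2 by rewrite subrr expr0n.
  apply: (@cvg_comp _ _ _ (fun j => f x - g j x) (fun y : R => y ^+ 2));
    last exact: exprn_continuous.
  by apply: cvgB; [exact: cvg_cst|exact: gf].
by move=> j x; rewrite -rmorphB sqmod_real.
Qed.

Lemma integrable_one : nu.-integrable setT (EFin \o (fun _ : R => 1 : R)).
Proof. by apply: bmeasurable_integrable; exact: bmeasurable_cst. Qed.

(** The sets whose indicator is approximable form a lambda-system, and half-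
    lines belong to it because ramps do. *)
Lemma approximable_indic A : measurable A ->
  approximable (fun x => (\1_A x)%:C%C).
Proof.
move=> mA; pose H :=
  [set A | measurable A /\ approximable (fun x => (\1_A x)%:C%C)].
suff : H A by case.
(* The constant 1 dominates all the squared distances between indicators and
   functions with values in the unit interval. *)
have indic_dist (a b : bool) : (a%:R - b%:R) ^+ 2 <= 1 :> R.
  by case: a; case: b; rewrite ?subrr ?subr0 ?sub0r ?sqrrN ?expr0n ?expr1n.
apply: borel_induction mA => {A}.
  split=> //.
  - split=> //; rewrite (_ : (fun x => _) = (fun=> 1));
    first exact: approximable_cst.
    by apply/funext => x; rewrite indicT.
  - move=> A C CA [mA aA] [mC aC]; split; first exact: measurableD.
    rewrite (_ : (fun x => _) = (fun x =>
      (\1_A x)%:C%C + (- 1) * (\1_C x)%:C%C)).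
      apply: approximableD => //.
      + by apply: cmeasurable_real; exact: measurable_indic.
      + by apply: cmeasurableZ; apply: cmeasurable_real;
        exact: measurable_indic.
      + by apply: approximableZ => //; apply: cmeasurable_real;
        exact: measurable_indic.
    apply/funext => x; rewrite mulN1r -rmorphB; congr (_%:C)%C.
    rewrite !indicE in_setD; have [Cx|Cx] := boolP (x \in C);
      last by rewrite andbT subr0.
    by rewrite (_ : x \in A) ?subrr//; rewrite !inE in Cx *; exact: CA.
  - move=> F ndF HF; have mF j : measurable (F j) by case: (HF j).
    have mU : measurable (\bigcup_j F j) by exact: bigcup_measurable.
    split=> //; apply: (@approximable_dominated_real _ (fun j => \1_(F j))
      (fun=> 1)) => //.
    + by move=> j; case: (HF j).
    + move=> x; apply: cvg_near_cst; have [Ux|Ux] :=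
      pselect ((\bigcup_j F j) x).
        case: (Ux) => k _ Fkx; near=> j.
        rewrite !indicE !mem_set//.
        have /subsetPset : (F k <= F j)%O by apply: ndF; near: j;
          exact: nbhs_infty_ge.
        exact.
      near=> j; rewrite !indicE !memNset// => Fjx; apply: Ux; by exists j.
    + exact: integrable_one.
move=> a; split; first exact: measurable_itv.
apply: (@approximable_dominated_real _
  (fun j x => clamp (- (j%:R * a) + j%:R * x)) (fun=> 1)) => //.
- move=> j; apply: continuous_measurable_fun; exact: continuous_clamp_affine.
- by move=> x; exact: ramp_cvg.
- exact: integrable_one.
move=> j x; rewrite indicE.
have := clamp_ge0 (- (j%:R * a) + j%:R * x);
  have := clamp_le1 (- (j%:R * a) + j%:R * x).
set t := clamp _ => t1 t0; rewrite -real_normK ?num_real// exprn_ile1//.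
by rewrite ler_norml; case: (_ \in _); rewrite /=; apply/andP; split; lra.
Unshelve. all: by end_near. Qed.

Import HBNNSimple.

Lemma approximable_nonneg (f : R -> R) : measurable_fun setT f ->
  (forall x, 0 <= f x) ->
  (\int[nu]_x ((f x) ^+ 2)%:E < +oo)%E -> approximable (fun x => (f x)%:C%C).
Proof.
move=> mf f0 fi;
  have mfE : measurable_fun setT (EFin \o f) by exact/measurable_EFinP.
have f0E x : [set: R] x -> (0 <= (EFin \o f) x)%E by move=> _; rewrite lee_fin.
pose g j := nnsfun_approx measurableT mfE j.
have gle j x : g j x <= f x.
  by rewrite -lee_fin /g nnsfun_approxE; exact: (le_approx j f0E).
apply: (@approximable_dominated_real f (fun j => g j : R -> R)
  (fun x => f x ^+ 2)) => //.
- move=> j; rewrite (_ : (fun x => _) = (fun x =>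
    \sum_(y <- fset_set (range (g j)))
      y%:C%C * (\1_(g j @^-1` [set y]) x)%:C%C)).
    have mI y : measurable (g j @^-1` [set y]) by exact: measurable_sfunP.
    apply: approximable_sum => [|y|y]; first exact: approximable_cst.
      by apply: cmeasurableZ; apply: cmeasurable_real; exact: measurable_indic.
    apply: approximableZ; last exact: approximable_indic.
    by apply: cmeasurable_real; exact: measurable_indic.
  apply/funext => x; rewrite fimfunE fsbig_finite//= rmorph_sum.
  by apply: eq_bigr => y _; rewrite rmorphM.
- move=> x; have /fine_cvgP[_] := cvg_nnsfun_approx measurableT mfE f0E
  (I : [set: R] x).
  exact.
- apply/integrableP; split; first by apply/measurable_EFinP;
  exact: measurable_funX.
  rewrite (eq_integral (fun x => (f x ^+ 2)%:E))// => x _.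
  by rewrite gee0_abs// lee_fin sqr_ge0.
move=> j x; have g0 : 0 <= g j x by [].
by rewrite lerXn2r ?nnegrE ?subr_ge0// lerBlDr lerDl.
Qed.

(** Split into positive and negative parts of the real and imaginary parts,
    and approximate each from below by simple functions. *)
Lemma approximable_L2 f : cmeasurable f -> (L2sq f < +oo)%E -> approximable f.
Proof.
move=> [mRe mIm] fi.
have part (h : R -> R) : measurable_fun setT h ->
  (forall x, h x ^+ 2 <= sqmod (f x)) ->
    approximable (fun x => (h x)%:C%C).
  move=> mh hf.
  have bound (h' : R -> R) : measurable_fun setT h' ->
      (forall x, h' x ^+ 2 <= h x ^+ 2) ->
        (\int[nu]_x ((h' x) ^+ 2)%:E < +oo)%E.
    move=> mh' h'h; apply: le_lt_trans fi; apply: ge0_le_integral => //.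
    - by move=> x _; rewrite lee_fin sqr_ge0.
    - by apply/measurable_EFinP; exact: measurable_funX.
    - exact: measurable_sqmod_EFin.
    by move=> x _; rewrite lee_fin (le_trans (h'h x)).
  have mp : measurable_fun setT h^\+ by exact: measurable_funrpos.
  have mn : measurable_fun setT h^\- by exact: measurable_funrneg.
  rewrite (_ : (fun x => _) = (fun x => (h^\+ x)%:C%C + (-1) * (h^\- x)%:C%C));
    last first.
    by apply/funext => x; rewrite mulN1r -rmorphB -[in LHS](funrposBneg h).
  have sq_le (a c : R) : 0 <= a -> a <= `|c| -> a ^+ 2 <= c ^+ 2.
    by move=> a0 ac; rewrite -[leRHS]real_normK ?num_real// lerXn2r ?nnegrE.
  have pos_le x : h^\+ x <= `|h x| by rewrite /funrpos ge_max normr_ge0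
    ler_norm.
  have neg_le x : h^\- x <= `|h x|.
    by rewrite /funrneg ge_max normr_ge0 -normrN ler_norm.
  apply: approximableD.
  - exact: cmeasurable_real.
  - by apply: cmeasurableZ; exact: cmeasurable_real.
  - apply: approximable_nonneg => //; apply: bound => // x.
    by apply: sq_le.
  - apply: approximableZ; first exact: cmeasurable_real.
    apply: approximable_nonneg => //; apply: bound => // x.
    by apply: sq_le.
rewrite (_ : f = fun x =>
  (complex.Re (f x))%:C%C + Complex 0 1 * (complex.Im (f x))%:C%C); last first.
  apply/funext => x; case: (f x) => a b; apply/eqP; rewrite eq_complex /=.
  by apply/andP; split; apply/eqP; ring.
apply: approximableD.
- exact: cmeasurable_real.
- by apply: cmeasurableZ; exact: cmeasurable_real.
- by apply: part => // x; rewrite lerDl sqr_ge0.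
apply: approximableZ; first exact: cmeasurable_real.
by apply: part => // x; rewrite lerDr sqr_ge0.
Qed.

End L2_closure.

(** * Measurability in the word *)

Section measurable_limits.
Context {R : realType}.

(** A function of the first letters is locally constant on the space of words,
    so its preimages are open. *)
Lemma measurable_cylinder (phi : Omega R -> R) k :
  (forall w w', (forall i, (i <= k)%N -> w i = w' i) -> phi w = phi w') ->
  measurable_fun [set: borel_Omega R] (phi : borel_Omega R -> R).
Proof.
move=> phik _ Y mY; apply: sub_sigma_algebra => /=.
rewrite setTI openE => w /= Yw; rewrite /interior.
apply/nbhs_ballP; exists (2 ^- k); first by rewrite /= invr_gt0 exprn_gt0.
move=> w' /=; rewrite ballEmdist /= => /Omega_dist_lt ww'.
by rewrite -(phik _ _ ww').
Qed.

Lemma Rint_ramp_cvg (nu : probability R R) (x : R) :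
  (fun j => \int[nu]_y clamp (- (j%:R * x) + j%:R * y)) @ \oo -->
  fine (nu `]x, +oo[%classic).
Proof.
have mray : measurable (`]x, +oo[%classic : set R) by exact: measurable_itv.
have m j : measurable_fun [set: R]
  (fun y => (clamp (- (j%:R * x) + j%:R * y))%:E).
  apply/measurable_EFinP; apply: continuous_measurable_fun.
  exact: continuous_clamp_affine.
have mi : measurable_fun [set: R] (fun y => (\1_(`]x, +oo[%classic) y : R)%:E).
  by apply/measurable_EFinP; exact: measurable_indic.
have c : {ae nu, forall y, [set: R] y ->
    (fun j => (clamp (- (j%:R * x) + j%:R * y))%:E) @ \oo -->
    (\1_(`]x, +oo[%classic) y : R)%:E}.
  by apply: aeW => y _; apply: cvg_EFin; [near=> j|exact: ramp_cvg].
have i1 := integrable_one nu.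
have dom : {ae nu, forall y j, [set: R] y ->
    (`|(clamp (- (j%:R * x) + j%:R * y))%:E| <=
      (EFin \o (fun _ : R => 1%R : R)) y)%E}.
  by apply: aeW => y j _; rewrite gee0_abs lee_fin ?clamp_ge0 ?clamp_le1.
have [_ _ cvg] := dominated_convergence measurableT m mi c i1 dom.
rewrite -Rint_indic//; apply: fine_cvg; rewrite fineK//.
by rewrite integral_indic// setIT fin_num_measure.
Unshelve. all: by end_near. Qed.

(** For a fixed ramp, the average over a finite level depends on finitely many
    letters; the integral against the limit is a limit of such functions, and
    measures of half-lines are limits of integrals of ramps. The pi-lambda
    theorem covers the other Borel sets. *)
Lemma random_measure_weak_limit (s : nat -> Omega R -> seq R)
    (M : Omega R -> probability R R) :
  (forall m, exists k, forall w w', (forall i, (i <= k)%N -> w i = w' i) ->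
    s m w = s m w') ->
  (forall w (f : R -> R), continuous f -> bounded_fun f ->
     (fun m => mean (s m w) f) @ \oo --> \int[M w]_x f x) ->
  random_measure (fun w => M w).
Proof.
move=> sk sM A mA; pose H := [set A : set R | measurable A /\
  measurable_fun [set: borel_Omega R] (fun w : borel_Omega R => M w A)].
suff : H A by case.
apply: borel_induction mA => {A}.
  split=> //.
  - split=> //; rewrite (_ : (fun w => _) = (fun=> 1%E));
    first exact: measurable_cst.
    by apply/funext => w; exact: probability_setT.
  - move=> A C CA [mA HA] [mC HC]; split; first exact: measurableD.
    rewrite (_ : (fun w => _) = (fun w => M w A - M w C)%E);
      first exact: emeasurable_funB.
    apply/funext => w; rewrite measureD//;
      last by rewrite -ge0_fin_numE// fin_num_measure.
    by rewrite (setIidr CA).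
  - move=> F ndF HF; have mF j : measurable (F j) by case: (HF j).
    have mU : measurable (\bigcup_j F j) by exact: bigcup_measurable.
    split=> //; apply: (emeasurable_fun_cvg
      (fun j (w : borel_Omega R) => M w (F j))).
      by move=> j; case: (HF j).
    by move=> w _; exact: nondecreasing_cvg_mu.
move=> x; split; first exact: measurable_itv.
rewrite (_ : (fun w => _) = EFin \o (fun w => fine (M w `]x, +oo[%classic)));
  last first.
  by apply/funext => w /=; rewrite fineK// fin_num_measure//;
    exact: measurable_itv.
apply/measurable_EFinP.
apply: (measurable_fun_cvg (h :=
  fun j (w : borel_Omega R) => \int[M w]_y clamp (- (j%:R * x) + j%:R * y)));
    last first.
  by move=> w _; exact: Rint_ramp_cvg.
move=> j; set f := fun y : R => clamp (- (j%:R * x) + j%:R * y).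
apply: (measurable_fun_cvg (h := fun m (w : borel_Omega R) => mean (s m w) f));
  last first.
  move=> w _; apply: sM; first exact: continuous_clamp_affine.
  exact: bounded_clamp_affine.
move=> m; have [k smk] := sk m; apply: (@measurable_cylinder _ k) => w w' /smk.
by move=> ->.
Qed.

End measurable_limits.

(** * The exponential basis of the limit *)

Section continuous_bounded.
Context {R : realType}.
Implicit Types f g : R -> R[i].

(** The complex-valued functions whose squared modulus can be tested against
    weak convergence. *)
Definition bcontinuous f := [/\ continuous (fun x : R => complex.Re (f x) : R),
  continuous (fun x : R => complex.Im (f x) : R) & exists K, forall x,
    sqmod (f x) <= K].

Lemma bcontinuousD f g : bcontinuous f -> bcontinuous g ->
  bcontinuous (fun x => f x + g x).
Proof.
move=> [f1 f2 [K fK]] [g1 g2 [L gL]]; split.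
- rewrite (_ : (fun x : R => _) =
  (fun x : R => complex.Re (f x) + complex.Re (g x))).
    by move=> x; apply: cvgD; [exact: f1|exact: g1].
  by apply/funext => x; case: (f x) (g x) => [? ?] [? ?].
- rewrite (_ : (fun x : R => _) =
  (fun x : R => complex.Im (f x) + complex.Im (g x))).
    by move=> x; apply: cvgD; [exact: f2|exact: g2].
  by apply/funext => x; case: (f x) (g x) => [? ?] [? ?].
exists (2 * K + 2 * L) => x; rewrite (le_trans (sqmodD_le _ _))//.
by rewrite lerD// ler_pM2l.
Qed.

Lemma bcontinuousM f g : bcontinuous f -> bcontinuous g ->
  bcontinuous (fun x => f x * g x).
Proof.
move=> [f1 f2 [K fK]] [g1 g2 [L gL]]; split.
- rewrite (_ : (fun x : R => _) =
  (fun x : R => complex.Re (f x) * complex.Re (g x)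
    - complex.Im (f x) * complex.Im (g x))).
    by move=> x; apply: cvgB; apply: cvgM;
      [exact: f1|exact: g1|exact: f2|exact: g2].
  by apply/funext => x; case: (f x) (g x) => [? ?] [? ?].
- rewrite (_ : (fun x : R => _) =
  (fun x : R => complex.Re (f x) * complex.Im (g x)
    + complex.Im (f x) * complex.Re (g x))).
    by move=> x; apply: cvgD; apply: cvgM;
      [exact: f1|exact: g2|exact: f2|exact: g1].
  by apply/funext => x; case: (f x) (g x) => [? ?] [? ?].
by exists (K * L) => x; rewrite sqmodM ler_pM// sqmod_ge0.
Qed.

Lemma bcontinuous_cst (c : R[i]) : bcontinuous (fun=> c).
Proof.
by split; [exact: cst_continuous|exact: cst_continuous|exists (sqmod c)].
Qed.

Lemma bcontinuous_sum (I : Type) (r : seq I) (F : I -> R -> R[i]) :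
  (forall i, bcontinuous (F i)) -> bcontinuous (fun x => \sum_(i <- r) F i x).
Proof.
move=> mF; elim: r => [|i r IH].
  by under eq_fun do rewrite big_nil; exact: bcontinuous_cst.
by under eq_fun do rewrite big_cons; exact: bcontinuousD.
Qed.

Lemma bcontinuous_cexp (l : R) : bcontinuous (fun x => cexp (l * x)).
Proof.
split; [exact: continuous_cos_mul|exact: continuous_sin_mul|].
by exists 1 => x; rewrite sqmod_cexp.
Qed.

Lemma bcontinuous_real (f : R -> R) : continuous f -> bounded_fun f ->
  bcontinuous (fun x => (f x)%:C%C).
Proof.
move=> cf /bounded_fun_boundP[K fK]; split => //=; first exact: cst_continuous.
exists (K ^+ 2) => x; rewrite /sqmod /= expr0n addr0 -real_normK ?num_real//.
have K0 := le_trans (normr_ge0 _) (fK x).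
by rewrite lerXn2r ?nnegrE.
Qed.

Lemma bcontinuous_sqmod f : bcontinuous f ->
  continuous (fun x => sqmod (f x)) /\ bounded_fun (fun x => sqmod (f x)).
Proof.
move=> [f1 f2 [K fK]]; split; last first.
  by apply/bounded_fun_boundP; exists K => x; rewrite ger0_norm ?sqmod_ge0.
move=> x; apply: cvgD.
  by apply: (@cvg_comp _ _ _ (fun x => complex.Re (f x)) (fun y => y ^+ 2));
    [exact: f1|exact: exprn_continuous].
by apply: (@cvg_comp _ _ _ (fun x => complex.Im (f x)) (fun y => y ^+ 2));
  [exact: f2|exact: exprn_continuous].
Qed.

Lemma mean_complex (T : eqType) (s : seq T) (g : T -> R[i]) :
  mean s g = Complex (mean s (fun x => complex.Re (g x)))
    (mean s (fun x => complex.Im (g x))).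
Proof.
rewrite (eq_mean
  (h := fun x =>
    (complex.Re (g x))%:C%C + Complex 0 1 * (complex.Im (g x))%:C%C)).
  rewrite meanD meanZ -(mean_rmorph (real_complex R))
    -(mean_rmorph (real_complex R)).
  by apply/eqP; rewrite eq_complex /=; apply/andP; split; apply/eqP; ring.
move=> x _; case: (g x) => a b; apply/eqP; rewrite eq_complex /=.
by apply/andP; split; apply/eqP; ring.
Qed.

End continuous_bounded.

Section exponential_basis.
Context {R : realType}.
Variables (M : nat -> nat) (b L : nat -> seq int).
Hypothesis M_ge2 : forall k, (2 <= M k)%N.
Hypothesis b_gt0 : forall k, (0 < size (b k))%N.
Hypothesis sizeL : forall k, size (L k) = size (b k).
Hypothesis L0 : forall k, 0 \in L k.
Hypothesis L_uniq : forall k, uniq (L k).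
Hypothesis L_small : forall k, {in L k, forall l, (2 * `|l| <= M k)%N}.
Hypothesis L_orth : forall k, {in L k &, forall l l', l != l' ->
  \sum_(x <- b k) cexp ((x * (l - l'))%:~R / (M k)%:R : R) = 0}.
(** E k i plays the role of the i-th digit set after the first k ones,
    rescaled by scale k; E_small says that the rescaled tails come arbitrarily
    close to 0 in mean. Both are proved above for the digits of a word. *)
Variable E : nat -> nat -> seq R.
Hypothesis E_ge0 : forall k i, {in E k i, forall z, 0 <= z}.
Hypothesis E_gt0 : forall k i, (0 < size (E k i))%N.
Hypothesis E_scale : forall k i,
  [seq (scale M (k + i).+1)%:R^-1 * x%:~R | x <- b (k + i)] =
  [seq (scale M k)%:R^-1 * z | z <- E k i].
Hypothesis E_small : forall d : R, 0 < d -> exists k, forall m,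
  mean (digit_sums (E k) m) clamp <= d.
Variable nu : probability R R.
Hypothesis nu_lim : forall f : R -> R, continuous f -> bounded_fun f ->
  (fun m => mean (points M b m) f) @ \oo --> \int[nu]_x f x.

Definition spectrum : set R :=
  [set l | exists k t, t \in spec M L k /\ l = t%:~R].

(** Two frequencies lie in a common level, on which, as on all later ones,
    they are orthogonal; orthogonality passes to the weak limit because the
    exponentials are bounded and continuous. *)
Lemma integral_cexp_spec k (t t' : int) : t \in spec M L k ->
  t' \in spec M L k ->
  cintegral nu (fun x => cexp ((t - t')%:~R * x)) = (t == t')%:R.
Proof.
move=> tS t'S; have [->|tt'] := eqVneq t t'.
  rewrite /cintegral (@eq_Rintegral _ _ _ nu setT (fun=> 1)); last first.
    by move=> x _; rewrite subrr mul0r cexp0.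
  rewrite Rint_cst (@eq_Rintegral _ _ _ nu setT (fun=> 0)); last first.
    by move=> x _; rewrite subrr mul0r cexp0.
  by rewrite Rint_cst.
have [c1 c2 [K cK]] := bcontinuous_cexp ((t - t')%:~R : R).
have mean0 m : (k <= m)%N ->
  mean (points M b m) (fun x : R => cexp ((t - t')%:~R * x)) = 0.
  move=> km; have [_ o] := spec_orthogonal M_ge2 b_gt0 L_uniq L_orth m.
  by apply: (o t t') => //;
    [exact: (spec_le L0 km tS)|exact: (spec_le L0 km t'S)].
have norm1 (z : R[i]) : sqmod z <= 1 ->
  `|complex.Re z| <= 1 /\ `|complex.Im z| <= 1.
  case: z => u v; rewrite /sqmod /= => uv; split.
    by rewrite -(@expr_le1 _ 2)// real_normK ?num_real//; have := sqr_ge0 v;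
      lra.
  by rewrite -(@expr_le1 _ 2)// real_normK ?num_real//; have := sqr_ge0 u; lra.
have lim0 (h : R -> R) : continuous h -> (forall x, `|h x| <= 1) ->
    (forall m, (k <= m)%N -> mean (points M b m) h = 0) -> \int[nu]_x h x = 0.
  move=> ch h1 h0; have bh : bounded_fun h by apply/bounded_fun_boundP;
    exists 1.
  apply: (cvg_unique _ (nu_lim ch bh)) => //.
  by apply: cvg_near_cst; near=> m; apply: h0; near: m; exact: nbhs_infty_ge.
rewrite /cintegral lim0//; last 2 first.
- by move=> x; apply: (norm1 _ _).1; rewrite sqmod_cexp.
- by move=> m /mean0; rewrite mean_complex => /eqP;
  rewrite eq_complex => /andP[/eqP].
rewrite lim0//.
- by move=> x; apply: (norm1 _ _).2; rewrite sqmod_cexp.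
- by move=> m /mean0; rewrite mean_complex => /eqP;
  rewrite eq_complex => /andP[_ /eqP].
Unshelve. all: by end_near. Qed.

(** Ramps are Lipschitz with values in the unit interval, so the mean square
    error of their Fourier sums of level k is at most a constant times the
    size of the rescaled tail after k, which is as small as desired for a
    suitable k. *)
Lemma approximable_ramp c r : approximable nu spectrum
  (fun x => (clamp (c + r * x))%:C%C).
Proof.
move=> eps eps0; set f := fun x : R => clamp (c + r * x).
have f1 x : `|f x| <= 1 by rewrite ger0_norm ?clamp_ge0 ?clamp_le1.
(* If |D| <= 1 and |D| <= |r| y then D^2 <= |D| <= K clamp y. *)
pose K := `|r| + 1; have K0 : 0 <= K by rewrite addr_ge0.
have fK x y : 0 <= y -> (f (x + y) - f x) ^+ 2 <= K * clamp y.
  move=> y0; set D := f (x + y) - f x.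
  have D1 : `|D| <= 1.
    rewrite ler_norml /D /f; have := clamp_ge0 (c + r * x);
      have := clamp_le1 (c + r * x).
    by have := clamp_ge0 (c + r * (x + y)); have := clamp_le1 (c + r * (x + y));
      lra.
  have Dr : `|D| <= `|r| * y.
    rewrite (le_trans (clamp_lipschitz _ _))//.
    have -> : c + r * (x + y) - (c + r * x) = r * y by ring.
    by rewrite normrM (ger0_norm y0).
  have DD : D ^+ 2 <= `|D| by rewrite -real_normK ?num_real// expr2 ler_piMl.
  have [y1|y1] := leP 1 y.
    by rewrite clamp_eq1// mulr1 /K; have := normr_ge0 r; lra.
  rewrite /clamp max_r// (min_r (ltW y1)) /K mulrDl mul1r; lra.
have dK : 0 < 2 * K + 32 by rewrite ltr_wpDl// mulr_ge0.
have [k kE] := E_small (divr_gt0 (divr_gt0 eps0 (ltr0Sn R 1)) dK).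
pose h := fourier_sum M b L k f.
have err m : mean (points M b (k + m)) (fun x => sqmod ((f x)%:C%C - h x)) <=
  eps / 2.
  apply: le_trans (fourier_sum_error M_ge2 b_gt0 sizeL L_uniq L_small L_orth
    f1 fK K0 (@E_ge0 k) (E_gt0 k) (E_scale k) (kE m)) _.
  by rewrite mulrC divfK// gt_eqF.
have cf : continuous f by exact: continuous_clamp_affine.
have bf : bounded_fun f by exact: bounded_clamp_affine.
have ch : bcontinuous h.
  apply: bcontinuous_sum => t; apply: bcontinuousM;
    [exact: bcontinuous_cst|exact: bcontinuous_cexp].
have cfh : bcontinuous (fun x => (f x)%:C%C - h x).
  under eq_fun do rewrite -mulN1r.
  apply: bcontinuousD; first exact: bcontinuous_real.
  by apply: bcontinuousM => //; exact: bcontinuous_cst.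
have [cn bn] := bcontinuous_sqmod cfh.
exists h.
  pose S := [seq (t%:~R : R) | t <- spec M L k].
  exists [fset x in S]%fset, (fun l => mean (points M b k)
    (fun x => (f x)%:C%C * (cexp (l * x))^*)); split.
    by move=> l /=; rewrite !inE => /mapP[t tS ->]; exists k, t.
  move=> x; rewrite /h /fourier_sum.
  have [uS _] := spec_orthogonal M_ge2 b_gt0 L_uniq L_orth k.
  rewrite (perm_big S) ?big_map//=; apply: uniq_perm.
  - exact: fset_uniq.
  - by rewrite map_inj_uniq//; exact: intr_inj.
  - by move=> l; rewrite !inE.
have bmeasurable_fh := bmeasurable_continuous cn bn.
have -> : L2sq nu (fun x => (f x)%:C%C - h x) =
    (\int[nu]_x sqmod ((f x)%:C%C - h x))%:E.
  by rewrite /Rintegral fineK//; apply: integrable_fin_num => //;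
    exact: bmeasurable_integrable.
rewrite lte_fin; apply: (@le_lt_trans _ _ (eps / 2)); last first.
  by rewrite ltr_pdivrMr// ltr_pMr// ltr1n.
have lim := nu_lim cn bn.
rewrite -(cvg_lim _ lim)//; apply: limr_le; first exact: cvgP lim.
near=> m; rewrite -(subnKC (_ : k <= m)%N); first exact: err.
by near: m; exact: nbhs_infty_ge.
Unshelve. all: by end_near. Qed.

Lemma spectral_measure_limit : spectral_measure nu.
Proof.
split; first exact: probability_setT.
exists spectrum; split.
- move=> l _; have [m1 m2] := cmeasurable_cexp l; split=> //.
  rewrite sqnormL2E /L2sq (eq_integral (cst 1%E)); last first.
    by move=> x _; rewrite sqmod_cexp.
  by rewrite integral_cst// mul1e;
    exact: (le_lt_trans (probability_le1 nu measurableT) (ltry 1)).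
- move=> _ _ [k [t [tS ->]]] [k' [t' [t'S ->]]].
  rewrite (inj_eq (@intr_inj R)).
  rewrite -(@integral_cexp_spec (maxn k k')); last 2 first.
  + by apply: (spec_le L0 (leq_maxl k k')).
  + by apply: (spec_le L0 (leq_maxr k k')).
  rewrite /dotL2; congr cintegral; apply/funext => x.
  by rewrite -cexpN -cexpD rmorphB mulrBl.
move=> f [m1 m2 fi] eps eps0.
have := approximable_L2 approximable_ramp (conj m1 m2); rewrite -sqnormL2E.
move=> /(_ fi _ eps0)[p [s [c [sL pE]]] fp]; exists s, c; split=> //.
by rewrite sqnormL2E; under eq_fun do rewrite -pE.
Qed.

End exponential_basis.

Section assembly.
Context {R : realType}.
Variables (N : nat -> nat) (B : nat -> {fset int}) (n : nat -> nat).
Hypothesis N_gt0 : forall k, (0 < N k)%N.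

(** The levels of the convolution are the lists of sums shifted by one, since
    the k-th finite convolution has k + 1 factors. *)
Lemma infinite_conv_limitsP (w : Omega R) (nu : probability R R) :
  infinite_conv_limits N B n w nu <->
  forall f : R -> R, continuous f -> bounded_fun f ->
    (fun m => mean (digit_sums (digits N B n w) m) f) @ \oo --> \int[nu]_x f x.
Proof.
have E (f : R -> R) : continuous f ->
  (fun k => \int[finite_conv N B n w k]_x f x) =
    (fun k => mean (digit_sums (digits N B n w) k.+1) f).
  move=> cf; apply/funext => k; rewrite Rintegral_finite_conv//.
  exact: continuous_measurable_fun.
split=> H f cf bf; have := H f cf bf; rewrite ?E// => H'; last first.
  by rewrite -cvg_shiftS in H'.
by rewrite -cvg_shiftS.
Qed.

Lemma prod_scale (w : nat -> nat) k :
  \prod_(j < k) (N (w j))%:R ^- n j = (scale (fun j => N (w j) ^ n j)%N k)%:R^-1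
    :> R.
Proof.
rewrite /scale natr_prod prodfV; congr (_^-1); apply: eq_bigr => j _.
by rewrite natrX.
Qed.

Lemma weight_scale (w : nat -> nat) k :
  weight N n w k = (scale (fun j => N (w j) ^ n j)%N k.+1)%:R^-1 :> R.
Proof. exact: prod_scale. Qed.

Lemma digits_points (w : nat -> nat) k :
  digit_sums (digits N B n w) k = points (fun j => N (w j) ^ n j)%N
    (fun j => enum_fset (B (w j))) k :> seq R.
Proof.
congr (digit_sums _ k); apply/funext => i; apply: eq_map => x; congr (_ * _).
exact: weight_scale.
Qed.

End assembly.

Theorem theorem1p3 (R : realType) (N : nat -> nat) (B : nat -> {fset int})
    (admNB : forall k, @admissible_pair R (N k) (B k))
    (B_ge0 : forall k b, b \in B k -> 0 <= b)
    (mu_exists : forall w : Omega R, infinite_conv_exists N B (fun=> 1%N) w)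
    (Phi_tight :
       tight [set infinite_conv N B (fun=> 1%N) w | w in [set: Omega R]])
    (n : nat -> nat) (n_gt0 : forall k, (0 < n k)%N)
    (n_unbounded : forall m : nat, exists k, (m < n k)%N) :
  (forall w : Omega R, infinite_conv_exists N B n w) /\
  spectral_random_measure (fun w : Omega R => infinite_conv N B n w).
Proof.
have N_ge2 k : (2 <= N k)%N by case: (admNB k).
have N_gt0 k : (0 < N k)%N by rewrite ltnW.
have B_gt0 k : (0 < #|` B k|)%N by case: (admNB k) => _ /ltnW.
have ex (w : Omega R) : infinite_conv_exists N B n w.
  have [|||nu nuP] := @exists_limit_law R (digits N B n w).
  - exact: size_digits_gt0.
  - exact: digits_ge0.
  - by apply: digits_tail.
  by exists nu; apply/infinite_conv_limitsP.
have lim (w : Omega R) : forall f : R -> R, continuous f -> bounded_fun f ->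
    (fun m => mean (digit_sums (digits N B n w) m) f) @ \oo -->
      \int[infinite_conv N B n w]_x f x.
  by apply/infinite_conv_limitsP => //; apply: xgetPex; exact: ex.
split=> //; split.
  apply: (@random_measure_weak_limit _
    (fun m w => digit_sums (digits N B n w) m)) => // m.
  exists m => w w' ww'; apply: eq_digit_sums => i im;
    rewrite /digits ww' ?(ltnW im)//.
  apply: eq_map => b; congr (_ * _); apply: eq_bigr => j _; rewrite ww'//.
  by rewrite (leq_trans _ (ltnW im))// -ltnS.
move=> w.
have /choice[L LP] k := balanced_Hadamard_set (admNB (w k)) (n_gt0 k).
pose M j := (N (w j) ^ n j)%N.
pose b j := enum_fset (B (w j)).
pose tail k := digits N B (fun j => n (k + j)%N) (fun j => w (k + j)%N) : nat ->
  seq R.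
apply: (@spectral_measure_limit R M b L _ _ _ _ _ _ _ tail).
- move=> k; apply: leq_trans (N_ge2 (w k)) _.
  by rewrite -[X in (X <= _)%N]expn1 leq_exp2l.
- by move=> k; exact: B_gt0.
- by move=> k; case: (LP k).
- by move=> k; case: (LP k).
- by move=> k; case: (LP k).
- by move=> k; case: (LP k).
- by move=> k; case: (LP k).
- by move=> k; exact: digits_ge0.
- by move=> k; exact: size_digits_gt0.
- move=> k i;
  rewrite -weight_scale -[LHS]/(digits N B n w (k + i)) digits_shift.
  apply: eq_map => z; congr (_ * _); exact: prod_scale.
- move=> d d0; have [q qP] := rescaled_tails_near0 N_ge2 B_gt0 B_ge0 mu_exists
  Phi_tight d0.
  have [k qk] := n_unbounded q; exists k => m; apply: qP => //.
  by rewrite addn0.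
by move=> f cf bf; under eq_fun do rewrite -digits_points; exact: lim.
Qed.
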